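(* Let $(R,\mathfrak m)$ be a local ring, $X$ an Artinian $R$-module of N.dimension $d$, and $\underline{x}=(x_1,\ldots,x_d)\subseteq\mathfrak m$ such that $0:_X\underline{x}$ has finite length. If $X$ is co-Cohen-Macaulay, then $$H^d_{\underline{x}}(H_d^{\underline{x}}(X))\cong X,$$ where in $H^d_{\underline{x}}$ (local cohomology) $\underline{x}$ is also interpreted as the ideal generated by $x_1,\ldots,x_d$.
   Context: Local ring means commutative Noetherian local ring. $H^d_{\underline{x}}(-)$ (superscript $d$) is the $d$-th local cohomology functor with respect to the ideal $(x_1,\ldots,x_d)$; $H_d^{\underline{x}}(-)$ (subscript $d$) is local homology, defined as follows. Let $(A,\mathfrak n)$ be a commutative quasi-local ring and $X$ an Artinian $A$-module. For a sequence $\underline{x}=(x_1,\ldots,x_r)$ in $\mathfrak n$ and an integer $i$, the $i$-th local homology module of $X$ with respect to $\underline{x}$ is $$H_i^{\underline{x}}(X)=\varprojlim_{n} H_i(K_\bullet(x_1^n,\ldots,x_r^n;X)),$$ where $K_\bullet(x_1^n,\ldots,x_r^n;X)$ is the Koszul complex of $X$ with respect to $x_1^n,\ldots,x_r^n$, with transition maps induced by the standard maps of Koszul complexes $K_\bullet(x_1^{n+1},\ldots,x_r^{n+1};X)\to K_\bullet(x_1^n,\ldots,x_r^n;X)$ which multiply the component indexed by $e_{j_1}\wedge\cdots\wedge e_{j_p}$ by $x_{j_1}\cdots x_{j_p}$. In particular, for $i=r$ the system is $\{0:_X(x_1^n,\ldots,x_r^n)\}_n$ with transition maps multiplication by $x_1\cdots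 x_r$. Here $0:_X(y_1,\ldots,y_k)=\{u\in X: y_1u=\cdots=y_ku=0\}$ (equal to $X$ when $k=0$). The N.dimension (Noetherian dimension) $\mathrm{N.dim}_A(X)$ is defined inductively: $\mathrm{N.dim}_A(X)=-1$ when $X=0$; for an integer $r\ge 0$, put $\mathrm{N.dim}_A(X)=r$ when $\mathrm{N.dim}_A(X)<r$ is false and for every ascending chain $X_0\subseteq X_1\subseteq X_2\subseteq\cdots$ of submodules of $X$ there exists an integer $n$ such that $\mathrm{N.dim}_A(X_{m+1}/X_m)<r$ for all $m\ge n$. A sequence $x_1,\ldots,x_n\in\mathfrak n$ is $X$-coregular if multiplication by $x_i$ on $0:_X(x_1,\ldots,x_{i-1})$ is surjective for $i=1,\ldots,n$. The width $\mathrm{width}_A(X)$ is the length of a maximal $X$-coregular sequence in $\mathfrak n$. $X$ is co-Cohen-Macaulay if $\mathrm{width}_A(X)=\mathrm{N.dim}_A(X)$. *)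

(* Defs.v *)
From HB Require Import structures.
From mathcomp Require Import all_boot all_order all_algebra.
From mathcomp Require Import boolp classical_sets functions.

Set Implicit Arguments.
Unset Strict Implicit.
Unset Printing Implicit Defensive.

Import Order.TTheory GRing.Theory Num.Theory.
Local Open Scope ring_scope.

(* [submodClosed V] does not provide closure under opposite for a generic
   instance, hence this bundled version. Ideals of [R] are submodules of
   [R^o]. *)
Record submodule (R : comNzRingType) (V : lmodType R) := Submodule {
  submod_pred :> {pred V};
  submod_predP : GRing.submod_closed submod_pred
}.

HB.instance Definition _ (R : comNzRingType) (V : lmodType R)
  (S : submodule V) :=
  GRing.isSubmodClosed.Build R V (submod_pred S)
    (GRing.submod_closed_semi (submod_predP S)).

Section Constructions.
Variable R : comNzRingType.
Implicit Types U V W : lmodType R.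

Definition submod_type V (S : submodule V) : Type := {v : V | v \in S}.

HB.instance Definition _ V (S : submodule V) :=
  SubChoice.copy (submod_type S) {v : V | v \in S}.
HB.instance Definition _ V (S : submodule V) :=
  [SubChoice_isSubLmodule of submod_type S by <:].

Fact full_submod_closed V : GRing.submod_closed (predT : {pred V}).
Proof. by split. Qed.
Definition full_submod V := Submodule (full_submod_closed V).

Fact zero_submod_closed V : GRing.submod_closed (pred1 (0 : V) : {pred V}).
Proof.
split=> [|a u v]; first by rewrite inE.
by rewrite !inE => /eqP-> /eqP->; rewrite scaler0 addr0.
Qed.
Definition zero_submod V := Submodule (zero_submod_closed V).

Definition preim_pred U V (f : {linear U -> V}) (S : submodule V) : {pred U} :=
  fun u => f u \in S.
Fact preim_submod_closed U V (f : {linear U -> V}) (S : submodule V) :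
  GRing.submod_closed (preim_pred f S).
Proof.
split=> [|a u v Su Sv]; rewrite unfold_in /preim_pred.
  by rewrite linear0 rpred0.
by rewrite linearP rpredD ?rpredZ.
Qed.
Definition preim_submod U V (f : {linear U -> V}) (S : submodule V) :=
  Submodule (preim_submod_closed f S).

Definition im_pred U V (f : {linear U -> V}) (S : submodule U) : {pred V} :=
  fun v => `[< exists2 u, u \in S & f u = v >].
Fact im_submod_closed U V (f : {linear U -> V}) (S : submodule U) :
  GRing.submod_closed (im_pred f S).
Proof.
split=> [|a u v]; rewrite !unfold_in.
  by apply/asboolP; exists 0; rewrite ?rpred0 ?linear0.
move=> /asboolP[u' Su <-] /asboolP[v' Sv <-]; apply/asboolP.
by exists (a *: u' + v'); rewrite ?linearP // rpredD ?rpredZ.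
Qed.
Definition im_submod U V (f : {linear U -> V}) (S : submodule U) :=
  Submodule (im_submod_closed f S).

Definition cap_pred V (S T : submodule V) : {pred V} :=
  fun v => (v \in S) && (v \in T).
Fact cap_submod_closed V (S T : submodule V) :
  GRing.submod_closed (cap_pred S T).
Proof.
split=> [|a u v /andP[Su Tu] /andP[Sv Tv]]; rewrite unfold_in /cap_pred.
  by rewrite !rpred0.
by rewrite !rpredD ?rpredZ.
Qed.
Definition cap_submod V (S T : submodule V) := Submodule (cap_submod_closed S T).

Definition quot_mod V (S : submodule V) : Type := Quotient.quot (submod_pred S).

Section Quot.
Variables (V : lmodType R) (S : submodule V).
HB.instance Definition _ := GRing.Zmodule.on (quot_mod S).

Definition quot_pi (v : V) : quot_mod S := \pi_(Quotient.quot (submod_pred S))%qT v.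
Definition quot_repr (q : quot_mod S) : V :=
  repr (q : Quotient.quot (submod_pred S)).

Lemma quot_reprK : cancel quot_repr quot_pi.
Proof. by move=> q; apply: reprK. Qed.

Lemma quot_piE u v : (quot_pi u == quot_pi v) = (u - v \in S).
Proof. by rewrite /quot_pi Quotient.idealrBE. Qed.

Fact quot_pi_zmod_morphism : zmod_morphism quot_pi.
Proof. by move=> u v; rewrite /quot_pi raddfB. Qed.

Definition quot_scale (a : R) (q : quot_mod S) := quot_pi (a *: quot_repr q).

Lemma quot_scaleE a v : quot_scale a (quot_pi v) = quot_pi (a *: v).
Proof.
apply/eqP; rewrite quot_piE -scalerBr rpredZ // -quot_piE.
by rewrite quot_reprK.
Qed.

HB.instance Definition _ :=
  GRing.isZmodMorphism.Build V (quot_mod S) quot_pi quot_pi_zmod_morphism.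

Fact quot_scaleA a b q : quot_scale a (quot_scale b q) = quot_scale (a * b) q.
Proof. by rewrite -(quot_reprK q) !quot_scaleE scalerA. Qed.
Fact quot_scale1 : left_id 1 quot_scale.
Proof. by move=> q; rewrite -(quot_reprK q) quot_scaleE scale1r. Qed.
Fact quot_scaleDr : right_distributive quot_scale +%R.
Proof.
move=> a p q; rewrite -(quot_reprK q) -(quot_reprK p).
by rewrite -raddfD !quot_scaleE scalerDr raddfD.
Qed.
Fact quot_scaleDl q : {morph quot_scale^~ q : a b / a + b}.
Proof.
by move=> a b; rewrite -(quot_reprK q) !quot_scaleE scalerDl raddfD.
Qed.

HB.instance Definition _ := GRing.Zmodule_isLmodule.Build R (quot_mod S)
  quot_scaleA quot_scale1 quot_scaleDr quot_scaleDl.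

Fact quot_pi_scalable : scalable quot_pi.
Proof. by move=> a v; rewrite -quot_scaleE. Qed.
HB.instance Definition _ :=
  GRing.isScalable.Build R V (quot_mod S) *:%R quot_pi quot_pi_scalable.

End Quot.

(* [Z / (B :&: Z)] for submodules [B] and [Z] of [V]; this is [Z / B] in all
   the uses below, where [B] is contained in [Z]. *)
Definition subquot V (Z B : submodule V) : lmodType R :=
  quot_mod (preim_submod (\val : {linear submod_type Z -> V}) B).

Definition prod_mod (I : Type) (V : I -> lmodType R) : Type := forall i, V i.

Section Prod.
Variables (I : Type) (V : I -> lmodType R).
HB.instance Definition _ := gen_eqMixin (prod_mod V).
HB.instance Definition _ := gen_choiceMixin (prod_mod V).
Let T := prod_mod V.
Definition prod_zero : T := fun i => 0.
Definition prod_opp (f : T) : T := fun i => - f i.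
Definition prod_add (f g : T) : T := fun i => f i + g i.
Definition prod_scale (a : R) (f : T) : T := fun i => a *: f i.
Fact prod_addA : associative prod_add.
Proof. by move=> f g h; apply: functional_extensionality_dep => i; apply: addrA. Qed.
Fact prod_addC : commutative prod_add.
Proof. by move=> f g; apply: functional_extensionality_dep => i; apply: addrC. Qed.
Fact prod_add0 : left_id prod_zero prod_add.
Proof. by move=> f; apply: functional_extensionality_dep => i; apply: add0r. Qed.
Fact prod_addN : left_inverse prod_zero prod_opp prod_add.
Proof. by move=> f; apply: functional_extensionality_dep => i; apply: addNr. Qed.
HB.instance Definition _ :=
  GRing.isZmodule.Build (prod_mod V) prod_addA prod_addC prod_add0 prod_addN.
Fact prod_scaleA a b f : prod_scale a (prod_scale b f) = prod_scale (a * b) f.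
Proof. by apply: functional_extensionality_dep => i; apply: scalerA. Qed.
Fact prod_scale1 : left_id 1 prod_scale.
Proof. by move=> f; apply: functional_extensionality_dep => i; apply: scale1r. Qed.
Fact prod_scaleDr : right_distributive prod_scale +%R.
Proof. by move=> a f g; apply: functional_extensionality_dep => i; apply: scalerDr. Qed.
Fact prod_scaleDl f : {morph prod_scale^~ f : a b / a + b}.
Proof. by move=> a b; apply: functional_extensionality_dep => i; apply: scalerDl. Qed.
HB.instance Definition _ := GRing.Zmodule_isLmodule.Build R (prod_mod V)
  prod_scaleA prod_scale1 prod_scaleDr prod_scaleDl.
End Prod.

Definition lim_pred (V : nat -> lmodType R)
    (t : forall n, {linear V n.+1 -> V n}) : {pred prod_mod V} :=
  fun u => `[< forall n, t n (u n.+1) = u n >].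
Fact lim_submod_closed (V : nat -> lmodType R) (t : forall n, {linear V n.+1 -> V n}) :
  GRing.submod_closed (lim_pred t).
Proof.
split=> [|a u v]; rewrite !unfold_in.
  by apply/asboolP => n; apply: linear0.
by move=> /asboolP tu /asboolP tv; apply/asboolP => n; rewrite linearP tu tv.
Qed.
Definition inverse_limit (V : nat -> lmodType R)
    (t : forall n, {linear V n.+1 -> V n}) : lmodType R :=
  submod_type (Submodule (lim_submod_closed t)).

Section SubquotMap.
Variables (U V : lmodType R) (f : {linear U -> V}).
Variables (Z B : submodule U) (Z' B' : submodule V).
Hypothesis fZ : forall u, u \in Z -> f u \in Z'.
Hypothesis fB : forall u, u \in B -> f u \in B'.

Definition sub_map (z : submod_type Z) : submod_type Z' :=
  exist (fun v => v \in Z') (f (val z)) (fZ (valP z)).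

Definition subquot_map (q : subquot Z B) : subquot Z' B' :=
  quot_pi _ (sub_map (quot_repr q)).

Lemma subquot_mapE z : subquot_map (quot_pi _ z) = quot_pi _ (sub_map z).
Proof.
rewrite /subquot_map; set r := quot_repr _.
have: quot_pi (preim_submod \val B) r == quot_pi _ z by rewrite quot_reprK.
rewrite quot_piE => rzB; have {rzB}: val (r - z) \in B by [].
rewrite raddfB => /fB; rewrite raddfB => fB'.
by apply/eqP; rewrite quot_piE; change (val (sub_map r - sub_map z) \in B');
  rewrite raddfB.
Qed.

Fact subquot_map_linear : linear subquot_map.
Proof.
move=> a p q; rewrite -(quot_reprK p) -(quot_reprK q) -linearP.
rewrite !subquot_mapE -linearP; congr (quot_pi _ _).
by apply: val_inj; rewrite /= linearP.
Qed.
Definition subquot_lin : {linear subquot Z B -> subquot Z' B'} :=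
  HB.pack subquot_map
    (GRing.isLinear.Build R (subquot Z B) (subquot Z' B') *:%R subquot_map
       subquot_map_linear).
End SubquotMap.

End Constructions.

Section Finiteness.
Variable R : comNzRingType.
Implicit Types V W : lmodType R.

Definition lmod_iso V W := exists f : {linear V -> W}, bijective f.

Definition lmod_trivial V := forall v : V, v = 0.

Definition artinian V := forall F : nat -> submodule V,
  (forall n, {subset F n.+1 <= F n}) ->
  exists n, forall m, (n <= m)%N -> F m =i F n.

Definition noetherian V := forall F : nat -> submodule V,
  (forall n, {subset F n <= F n.+1}) ->
  exists n, forall m, (n <= m)%N -> F m =i F n.

Definition simple_mod V :=
  ~ lmod_trivial V /\
  forall S : submodule V, S =i zero_submod V \/ S =i full_submod V.

Definition finite_length V := exists (l : nat) (F : nat -> submodule V),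
  [/\ F 0%N =i zero_submod V, F l =i full_submod V &
      forall i, (i < l)%N ->
        {subset F i <= F i.+1} /\ simple_mod (subquot (F i.+1) (F i))].

(* [Ndim_step P V], where [P] stands for "N.dim < r", says that N.dim V = r. *)
Definition Ndim_step (P : lmodType R -> Prop) V :=
  ~ P V /\
  forall F : nat -> submodule V, (forall n, {subset F n <= F n.+1}) ->
    exists n, forall m, (n <= m)%N -> P (subquot (F m.+1) (F m)).

Fixpoint Ndim_lt (r : nat) V : Prop :=
  if r is s.+1 then Ndim_lt s V \/ Ndim_step (Ndim_lt s) V
  else lmod_trivial V.

Definition Ndim_eq V (r : int) : Prop :=
  match r with
  | Posz n => Ndim_step (Ndim_lt n) V
  | Negz 0 => lmod_trivial V
  | Negz _.+1 => False
  end.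

End Finiteness.

Section Width.
Variable R : comNzRingType.
Implicit Types (I J m : submodule R^o) (X : lmodType R) (s : seq R).

Definition maximal_ideal I :=
  (1 : R^o) \notin I /\
  forall J, {subset I <= J} -> (1 : R^o) \notin J -> {subset J <= I}.

Definition local_ring m :=
  [/\ noetherian R^o, maximal_ideal m & forall J, maximal_ideal J -> J =i m].

Definition colon_pred X s : {pred X} := fun u => all (fun a => a *: u == 0) s.
Fact colon_submod_closed X s : GRing.submod_closed (@colon_pred X s).
Proof.
split=> [|a u v /allP su /allP sv]; apply/allP => b bs.
  by rewrite scaler0.
rewrite scalerDr scalerA mulrC -scalerA.
by rewrite (eqP (su b bs)) (eqP (sv b bs)) scaler0 addr0.
Qed.
Definition colon X s : submodule X := Submodule (@colon_submod_closed X s).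

Definition coregular X s := forall i, (i < size s)%N ->
  forall u, u \in colon X (take i s) ->
    exists2 v, v \in colon X (take i s) & s`_i *: v = u.

Definition width_eq m X (w : nat) := exists s,
  [/\ {subset s <= m}, coregular X s, size s = w &
      forall a, a \in m -> ~ coregular X (rcons s a)].

Definition co_Cohen_Macaulay m X :=
  exists w : nat, width_eq m X w /\ Ndim_eq X w.

End Width.

Section LocalHomology.
Variables (R : comNzRingType) (r : nat) (X : lmodType R).
Implicit Types x : 'I_r -> R.

(* The family [f] stands for the sum, over all A = {j_1 < ... < j_p}, of
   e_(j_1) /\ ... /\ e_(j_p) (x) f A. *)
Definition koszul : lmodType R := {ffun {set 'I_r} -> X}.

Definition koszul_deg_pred (p : nat) : {pred koszul} :=
  fun f => [forall A : {set 'I_r}, (#|A| != p) ==> (f A == 0)].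
Fact koszul_deg_closed p : GRing.submod_closed (koszul_deg_pred p).
Proof.
split=> [|a f g /forallP fp /forallP gp]; apply/forallP => A.
  by rewrite ffunE eqxx implybT.
apply/implyP => pA; rewrite !ffunE.
by rewrite (eqP (implyP (fp A) pA)) (eqP (implyP (gp A) pA)) scaler0 addr0.
Qed.
Definition koszul_deg p : submodule koszul := Submodule (koszul_deg_closed p).

(* d (e_(j_1) /\ ... /\ e_(j_p)) is the sum of the
   (-1)^(s-1) x_(j_s) e_(j_1) /\ .. e_(j_s) omitted .. /\ e_(j_p). *)
Definition koszul_d x (f : koszul) : koszul :=
  [ffun B : {set 'I_r} => \sum_(j | j \notin B)
     ((-1) ^+ #|[set k in B | (k < j)%N]| * x j) *: f (j |: B)].
Fact koszul_d_linear x : linear (koszul_d x).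
Proof.
move=> a f g; apply/ffunP => B; rewrite !ffunE scaler_sumr -big_split /=.
apply: eq_bigr => j _; rewrite !ffunE scalerDr !scalerA.
by rewrite [a * _]mulrC.
Qed.
HB.instance Definition _ x :=
  GRing.isLinear.Build R koszul koszul *:%R (koszul_d x) (koszul_d_linear x).

Lemma koszul_dd x f : koszul_d x (koszul_d x f) = 0.
Proof.
apply/ffunP => B; rewrite !ffunE.
pose s j := #|[set k in B | (k < j)%N]|.
pose T (j k : 'I_r) :=
  ((-1) ^+ s j * x j * ((-1) ^+ (s k + (j < k)) * x k)) *: f (k |: (j |: B)).
pose N (j k : 'I_r) := [&& j \notin B, k \notin B & j != k].
transitivity (\sum_j \sum_(k | N j k) T j k).
  rewrite big_mkcond; apply: eq_bigr => j _; rewrite /N.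
  case: (boolP (j \in B)) => jB /=; first by rewrite big_pred0.
  rewrite ffunE scaler_sumr; apply: eq_big => [k|k].
    by rewrite !inE negb_or eq_sym andbC.
  rewrite !inE negb_or => /andP[kj kB]; rewrite scalerA /T; congr (_ * (_ ^+ _ * _) *: _).
  have [jk|jk] := ltnP j k; last first.
    rewrite addn0; apply: eq_card => l; rewrite !inE.
    by have [->|//] := eqVneq l j; rewrite ltnNge jk !andbF.
  rewrite addn1 -[RHS]/(1 + s k)%N -(_ : #|j |: [set l in B | (l < k)%N]| = (1 + s k)%N).
    by apply: eq_card => l; rewrite !inE; have [->|] := eqVneq l j.
  by rewrite cardsU1 inE (negPf jB).
rewrite pair_big_dep /= (bigID (fun p : 'I_r * 'I_r => p.1 < p.2)%N) /=.
rewrite [X in _ + X](reindex_inj (h := fun p => (p.2, p.1))) /=; last first.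
  by move=> [a b] [c d] [-> ->].
rewrite [X in _ + X](eq_bigl
  (fun p : 'I_r * 'I_r => N p.1 p.2 && (p.1 < p.2)%N)); last first.
  move=> [j k] /=; rewrite /N -leqNgt [k == j]eq_sym.
  have [->|jk] := eqVneq j k; first by rewrite !andbF.
  by rewrite [(j < k)%N]ltn_neqAle jk andbCA.
rewrite -big_split big1 // => -[j k] /= /andP[_ jk].
rewrite /T jk ltnNge ltnW //= finset.setUCA -scalerDl addn0 addn1 exprS.
by rewrite mulN1r mulNr mulrN [X in - X + _]mulrC addNr scale0r.
Qed.

Definition koszul_cycles x (p : nat) : submodule koszul :=
  cap_submod (koszul_deg p) (preim_submod (koszul_d x) (zero_submod koszul)).
Definition koszul_bounds x (p : nat) : submodule koszul :=
  im_submod (koszul_d x) (koszul_deg p.+1).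
Definition koszul_homology x (p : nat) : lmodType R :=
  subquot (koszul_cycles x p) (koszul_bounds x p).

Definition koszul_t x (f : koszul) : koszul :=
  [ffun A : {set 'I_r} => (\prod_(j in A) x j) *: f A].
Fact koszul_t_linear x : linear (koszul_t x).
Proof.
move=> a f g; apply/ffunP => B; rewrite !ffunE scalerDr !scalerA.
by rewrite [a * _]mulrC.
Qed.
HB.instance Definition _ x :=
  GRing.isLinear.Build R koszul koszul *:%R (koszul_t x) (koszul_t_linear x).

Definition pow x (n : nat) : 'I_r -> R := fun i => x i ^+ n.

Lemma koszul_t_deg x p f : f \in koszul_deg p -> koszul_t x f \in koszul_deg p.
Proof.
move=> /forallP fp; apply/forallP => A; apply/implyP => pA.
by rewrite ffunE (eqP (implyP (fp A) pA)) scaler0.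
Qed.

Lemma koszul_td x n f :
  koszul_d (pow x n) (koszul_t x f) = koszul_t x (koszul_d (pow x n.+1) f).
Proof.
apply/ffunP => B; rewrite !ffunE scaler_sumr; apply: eq_bigr => j jB.
rewrite !ffunE !scalerA big_setU1 //= /pow exprSr; congr (_ *: _).
by rewrite [RHS]mulrC !mulrA.
Qed.

Lemma koszul_t_cycles x p n f :
  f \in koszul_cycles (pow x n.+1) p -> koszul_t x f \in koszul_cycles (pow x n) p.
Proof.
move=> /andP[fp /eqP df]; apply/andP; split; first exact: koszul_t_deg.
apply/eqP; change (koszul_d (pow x n) (koszul_t x f) = 0).
by rewrite koszul_td df linear0.
Qed.

Lemma koszul_t_bounds x p n f :
  f \in koszul_bounds (pow x n.+1) p -> koszul_t x f \in koszul_bounds (pow x n) p.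
Proof.
move=> /asboolP[g gp <-]; apply/asboolP; exists (koszul_t x g).
  exact: koszul_t_deg.
exact: koszul_td.
Qed.

Definition koszul_homology_t x p n :
    {linear koszul_homology (pow x n.+1) p -> koszul_homology (pow x n) p} :=
  @subquot_lin R koszul koszul (koszul_t x) _ _ _ _
    (@koszul_t_cycles x p n) (@koszul_t_bounds x p n).

(* The index [n] of the inverse system stands for the exponent n + 1 >= 1. *)
Definition local_homology (i : nat) x : lmodType R :=
  inverse_limit (fun n => koszul_homology_t x i n.+1).

End LocalHomology.

Definition injective_mod (R : comNzRingType) (E : lmodType R) : Prop :=
  forall (A B : lmodType R) (f : {linear A -> B}) (g : {linear A -> E}),
    injective f -> exists h : {linear B -> E}, forall a, h (f a) = g a.

Record inj_resolution (R : comNzRingType) (M : lmodType R) := InjResolution {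
  res_obj : nat -> lmodType R;
  res_d : forall n, {linear res_obj n -> res_obj n.+1};
  res_aug : {linear M -> res_obj 0};
  res_inj : forall n, injective_mod (res_obj n);
  res_aug_inj : injective res_aug;
  res_exact0 : forall e, res_d 0 e = 0 <-> exists u, res_aug u = e;
  res_exact : forall n e, res_d n.+1 e = 0 <-> exists u, res_d n u = e
}.

(* M embeds into the injective module
   Hom_Z(R, D), where D is the divisible group (Q/Z)^(Hom_Z(M, Q/Z)). *)

Section Divisible.
Variables (B D : zmodType).
Implicit Types G : set (B * D).

Definition divisible := forall (n : nat) (y : D),
  (0 < n)%N -> exists z, z *+ n = y.

Definition addgraph G :=
  [/\ G 0, forall p q, G p -> G q -> G (p - q) & forall y, G (0, y) -> y = 0].

Lemma addgraphN G p : addgraph G -> G p -> G (- p).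
Proof. by move=> [G0 GB _] Gp; rewrite -[- p]add0r; apply: GB. Qed.
Lemma addgraphD G p q : addgraph G -> G p -> G q -> G (p + q).
Proof.
move=> aG Gp Gq; rewrite -[q]opprK; case: (aG) => _ GB _.
by apply: GB => //; apply: addgraphN.
Qed.
Lemma addgraphMz G p k : addgraph G -> G p -> G (p *~ k).
Proof.
move=> aG Gp; have Gn n : G (p *+ n).
  elim: n => [|n IHn]; first by rewrite mulr0n; case: aG.
  by rewrite mulrS; apply: addgraphD.
case: k => n; first by rewrite -pmulrn.
by rewrite NegzE mulrNz -pmulrn; apply: addgraphN.
Qed.

Lemma pair_mulrz (b : B) (y : D) k : (b, y) *~ k = (b *~ k, y *~ k).
Proof.
have Hn n : (b, y) *+ n = (b *+ n, y *+ n).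
  by elim: n => [|n IHn]; rewrite ?mulr0n // !mulrS IHn.
by case: k => n; rewrite ?NegzE ?mulrNz -!pmulrn Hn.
Qed.

Hypothesis divD : divisible.

Lemma addgraph_step G b : addgraph G ->
  exists z, forall (k : int) y, G (b *~ k, y) -> y = z *~ k.
Proof.
move=> aG; have [G0 GB Gf] := aG.
pose P n := `[< (0 < n)%N /\ exists y, G (b *+ n, y) >].
have [exP|nexP] := pselect (exists n, P n); last first.
  exists 0 => k y Gy; rewrite mul0rz.
  have [k0|k0] := eqVneq k 0; first by apply: Gf; rewrite k0 mulr0z in Gy.
  case: nexP; exists `|k|%N; apply/asboolP; rewrite absz_gt0; split=> //.
  case: k Gy {k0} => n Gy; first by exists y; exact: Gy.
  exists (- y); have Gn : G (- (b *~ Negz n), - y) := addgraphN aG Gy.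
  by rewrite NegzE mulrNz opprK -pmulrn in Gn.
case: (ex_minnP exP) => n /asboolP[n0 [y Gy]] minn_.
have [z zn] := divD y n0; exists z => k y' Gy'.
set q := (k %/ n)%Z; set s := (k %% n)%Z.
have kE : k = q * n + s by exact: divz_eq.
have nz : n%:Z != 0 by rewrite eqz_nat -lt0n.
have s0 : 0 <= s by rewrite modz_ge0.
have sn : s < n by rewrite ltz_pmod.
have Gs : G (b *~ s, y' - y *~ q).
  have Gq := addgraphMz q aG Gy; rewrite pair_mulrz in Gq.
  have Gs : G (b *~ k - b *+ n *~ q, y' - y *~ q) := GB _ _ Gy' Gq.
  rewrite kE mulrzDr pmulrn -mulrzA [n%:Z * q]mulrC addrAC subrr add0r in Gs.
  exact: Gs.
have sE : s = 0.
  move: Gs s0 sn; case: (s) => // -[|m] // Gm _ mn.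
  have: (n <= m.+1)%N.
    by apply: minn_; apply/asboolP; split=> //; exists (y' - y *~ q); rewrite pmulrn.
  by rewrite leqNgt => /negP[].
move: Gs; rewrite sE mulr0z => /Gf /eqP; rewrite subr_eq0 => /eqP ->.
by rewrite kE sE addr0 -zn pmulrn -mulrzA mulrC.
Qed.

Lemma addgraph_extend G0 : addgraph G0 ->
  exists h : {additive B -> D}, forall b y, G0 (b, y) -> h b = y.
Proof.
move=> aG0.
pose P (G : set (B * D)) := G = set0 \/ (addgraph G /\ G0 `<=` G)%classic.
have [G [PG maxG]] : exists G, P G /\ forall H, (G `<` H)%classic -> ~ P H.
  apply: Zorn_bigcup => F FP totF.
  have [[H [FH H0]]|nH] := pselect (exists H, F H /\ H <> set0); last first.
    left; rewrite -subset0 => p [H FH Hp]; apply: nH; exists H; split=> // H0.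
    by rewrite H0 in Hp.
  have good K : F K -> K <> set0 -> (addgraph K /\ G0 `<=` K)%classic.
    by move=> FK K0; case: (FP K FK).
  right; have [[Hz _ _] G0H] := good H FH H0.
  split; last by move=> p /G0H Hp; exists H.
  split; first by exists H.
  - move=> p q [K FK Kp] [L FL Lq].
    have [K1 K2] : K <> set0 /\ L <> set0.
      by split=> E; [rewrite E in Kp|rewrite E in Lq].
    have [[_ KB _] _] := good K FK K1; have [[_ LB _] _] := good L FL K2.
    case: (totF K L FK FL) => S.
      by exists L => //; apply: LB => //; apply: S.
    by exists K => //; apply: KB => //; apply: S.
  - move=> y [K FK Ky]; have K0 : K <> set0 by move=> E; rewrite E in Ky.
    by have [[_ _ Kf] _] := good K FK K0; apply: Kf.
have [aG G0G] : (addgraph G /\ G0 `<=` G)%classic.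
  case: PG => // GE; have PG0 : P G0 by right; split.
  suff GG0 : (G `<` G0)%classic by case: (maxG _ GG0).
  split; first by rewrite GE; apply: sub0set.
  by rewrite GE => S; case: aG0 => /S.
have [Gz GB Gf] := aG.
have tot b : exists y, G (b, y).
  have [z zP] := addgraph_step b aG; apply: contrapT => nb.
  pose H : set (B * D) :=
    fun p => exists q k, G q /\ p = (q.1 + b *~ k, q.2 + z *~ k).
  have GH : (G `<=` H)%classic.
    by move=> p Gp; exists p, 0; rewrite !mulr0z !addr0 -surjective_pairing.
  apply: (maxG H).
    split=> // HG; apply: nb; exists z; apply: HG; exists 0, 1.
    by rewrite !mulr1z !add0r.
  right; split; last exact: (subset_trans G0G GH).
  split; first exact: GH.
  - move=> _ _ [p [k [Gp ->]]] [q [l [Gq ->]]]; exists (p - q), (k - l).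
    split; first exact: GB.
    rewrite !mulrzBr; congr pair => /=; rewrite opprD addrACA //.
  - move=> y [[u v] [k [Gq [/= uE ->]]]].
    have uE' : b *~ k = - u.
      by apply/eqP; rewrite -addr_eq0 addrC -uE.
    have := addgraphN aG Gq; rewrite (_ : - (u, v) = (b *~ k, - v)).
      by move=> /zP <-; rewrite subrr.
    by rewrite uE'.
pose h b := projT1 (cid (tot b)).
have hG b : G (b, h b) by rewrite /h; case: cid.
have hE b y : G (b, y) -> h b = y.
  move=> Gy; apply/eqP; rewrite -subr_eq0; apply/eqP/Gf.
  by have := GB _ _ (hG b) Gy; rewrite -[in X in _ -> X](subrr b).
have hB : zmod_morphism h by move=> a b; apply: hE; exact: (GB _ _ (hG a) (hG b)).
pose hA : {additive B -> D} :=
  HB.pack h (GRing.isZmodMorphism.Build B D h hB).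
by exists hA => b y /G0G /hE.
Qed.

End Divisible.

Definition ratZ : zmodClosed rat :=
  GRing.ZmodClosed.clone rat (@Num.int_num_subdef rat) _.
Definition QZ : zmodType := Quotient.quot ratZ.
Definition QZ_pi (q : rat) : QZ := \pi_(Quotient.quot ratZ)%qT q.

Lemma QZ_piE q : (QZ_pi q == 0) = (q \is a Num.int).
Proof.
have -> : (0 : QZ) = QZ_pi 0 by rewrite /QZ_pi raddf0.
by rewrite /QZ_pi -Quotient.idealrBE subr0.
Qed.

Lemma QZ_piMz q k : QZ_pi q *~ k = QZ_pi (q *~ k).
Proof. by rewrite /QZ_pi raddfMz. Qed.

Lemma QZ_divisible : divisible QZ.
Proof.
move=> n y n0; pose q : rat := repr (y : Quotient.quot ratZ).
exists (QZ_pi (q / n%:R)); rewrite pmulrn QZ_piMz -pmulrn -(mulr_natr (q / _)).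
rewrite divfK ?pnatr_eq0 -?lt0n //; exact: reprK.
Qed.

Lemma QZ_separates (M : zmodType) (m : M) : m <> 0 ->
  exists h : {additive M -> QZ}, h m <> 0.
Proof.
move=> m0; pose P n := `[< (0 < n)%N /\ m *+ n = 0 >].
have [n [n1 nP]] : exists n, (1 < n)%N /\
    forall k : int, m *~ k = 0 -> (n %| k)%Z.
  have [exP|nexP] := pselect (exists n, P n); last first.
    exists 2; split=> // k mk; have [->|k0] := eqVneq k 0; first exact: dvdz0.
    case: nexP; exists `|k|%N; apply/asboolP; rewrite absz_gt0; split=> //.
    case: k mk {k0} => n; rewrite ?NegzE ?mulrNz ?abszN absz_nat -pmulrn //.
    by move=> /eqP; rewrite oppr_eq0 => /eqP.
  case: (ex_minnP exP) => n /asboolP[n0 mn] minn_.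
  exists n; split.
    rewrite ltnNge; apply/negP => n1; apply: m0.
    by have -> : m = m *+ n by have /eqP -> : n == 1%N by rewrite eqn_leq n1.
  move=> k mk; apply/dvdz_mod0P.
  have nz : n%:Z != 0 by rewrite eqz_nat -lt0n.
  have : m *~ (k %% n)%Z = 0.
    move: mk; rewrite {1}(divz_eq k n) mulrzDr mulrC mulrzA -pmulrn mn.
    by rewrite mul0rz add0r.
  have := ltz_pmod k (n0 : 0 < n%:Z); have := modz_ge0 k nz.
  case: (k %% n)%Z => // -[|s] // _ sn ms.
  have: (n <= s.+1)%N by apply: minn_; apply/asboolP; rewrite pmulrn.
  by rewrite leqNgt => /negP[].
pose z := QZ_pi n%:R^-1.
have n0 : n%:R != 0 :> rat by rewrite pnatr_eq0 -lt0n ltnW.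
pose G : set (M * QZ) := fun p => exists k : int, p = (m *~ k, z *~ k).
have aG : addgraph G.
  split; first by exists 0; rewrite !mulr0z.
    by move=> _ _ [k ->] [l ->]; exists (k - l); rewrite !mulrzBr.
  move=> y [k [/esym mk ->]]; have /dvdzP[q ->] := nP k mk.
  rewrite /z QZ_piMz mulrC mulrzA -pmulrn -(mulr_natl n%:R^-1) mulfV //.
  by apply/eqP; rewrite QZ_piE intr_int.
have [h hP] := addgraph_extend QZ_divisible aG.
exists h; rewrite (hP m z); last by exists 1; rewrite !mulr1z.
move=> /eqP; rewrite QZ_piE.
move=> /intrP[k /(congr1 (fun t => t * n%:R))]; rewrite mulVf // => kn.
have : (1 : int) = k * n%:Z by apply: (@intr_inj rat); rewrite rmorphM /= -kn.
move=> /(congr1 absz); rewrite abszM absz_nat => /esym/eqP.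
by rewrite /= muln_eq1 => /andP[_ /eqP nE]; rewrite nE in n1.
Qed.

Section HomZ.
Variables (R : comNzRingType) (D : zmodType).

Definition homZ_pred : {pred R -> D} := fun f => `[< zmod_morphism f >].
Fact homZ_closed : zmod_closed homZ_pred.
Proof.
split=> [|f g /asboolP fB /asboolP gB]; apply/asboolP => a b.
  by rewrite subr0.
by rewrite !fctE fB gB opprD addrACA -opprD.
Qed.
HB.instance Definition _ := GRing.isZmodClosed.Build _ homZ_pred homZ_closed.

Definition homZ : Type := {f : R -> D | f \in homZ_pred}.
HB.instance Definition _ := SubChoice.copy homZ {f : R -> D | f \in homZ_pred}.
HB.instance Definition _ := [SubChoice_isSubZmodule of homZ by <:].

Lemma homZB (f : homZ) : zmod_morphism (val f).
Proof. by apply/asboolP; exact: (valP f). Qed.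

Lemma homZD (f : homZ) a b : val f (a + b) = val f a + val f b.
Proof.
have f0 : val f 0 = 0 by have := homZB f 0 0; rewrite !subrr.
have fN c : val f (- c) = - val f c by have := homZB f 0 c; rewrite f0 !sub0r.
by have := homZB f a (- b); rewrite opprK fN opprK.
Qed.

Fact homZ_scale_subproof (a : R) (f : homZ) :
  (fun r => val f (r * a)) \in homZ_pred.
Proof. by apply/asboolP => r s; rewrite mulrBl homZB. Qed.
Definition homZ_scale (a : R) (f : homZ) : homZ :=
  exist (fun g => g \in homZ_pred) _ (homZ_scale_subproof a f).

Lemma homZ_ext (f g : homZ) : (forall r, val f r = val g r) -> f = g.
Proof. by move=> fg; apply/val_inj/funext. Qed.

Lemma homZ_addE (f g : homZ) r : val (f + g) r = val f r + val g r.
Proof. by []. Qed.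

Fact homZ_scaleA a b f : homZ_scale a (homZ_scale b f) = homZ_scale (a * b) f.
Proof. by apply: homZ_ext => r; rewrite /= mulrA. Qed.
Fact homZ_scale1 : left_id 1 homZ_scale.
Proof. by move=> f; apply: homZ_ext => r; rewrite /= mulr1. Qed.
Fact homZ_scaleDr : right_distributive homZ_scale +%R.
Proof. by move=> a f g; apply: homZ_ext. Qed.
Fact homZ_scaleDl f : {morph homZ_scale^~ f : a b / a + b}.
Proof. by move=> a b; apply: homZ_ext => r; rewrite /= mulrDr homZD. Qed.
HB.instance Definition _ := GRing.Zmodule_isLmodule.Build R homZ
  homZ_scaleA homZ_scale1 homZ_scaleDr homZ_scaleDl.

Lemma homZ_scaleE a (f : homZ) r : val (a *: f) r = val f (r * a).
Proof. by []. Qed.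

Lemma homZ_injective : divisible D -> injective_mod homZ.
Proof.
move=> divD A B f g finj.
pose G : set (B * D) := fun p => exists a, p = (f a, val (g a) 1).
have aG : addgraph G.
  split; first by exists 0; rewrite !linear0.
    by move=> _ _ [a ->] [b ->]; exists (a - b); rewrite !linearB.
  move=> y [a [/esym fa ->]]; have -> : a = 0 by apply: finj; rewrite fa linear0.
  by rewrite linear0.
have [h hP] := addgraph_extend divD aG.
have hin b : (fun r : R => h (r *: b)) \in homZ_pred.
  by apply/asboolP => r s; rewrite scalerBl raddfB.
pose k b : homZ := exist (fun g => g \in homZ_pred) _ (hin b).
have kL : linear k.
  by move=> a u v; apply: homZ_ext => r; rewrite /= scalerDr scalerA raddfD.
pose kl : {linear B -> homZ} := HB.pack k (GRing.isLinear.Build R B homZ *:%R k kL).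
exists kl => a; apply: homZ_ext => r /=.
rewrite -linearZ (hP _ (val (g (r *: a)) 1)); last by exists (r *: a).
by rewrite linearZ homZ_scaleE mul1r.
Qed.

End HomZ.

Section InjectiveHull.
Variables (R : comNzRingType) (M : lmodType R).

Definition charZ : zmodType := {additive M -> QZ} -> QZ.

Lemma charZ_divisible : divisible charZ.
Proof.
move=> n y n0; exists (fun c => projT1 (cid (QZ_divisible (y c) n0))).
apply/funext => c; rewrite -[RHS](projT2 (cid (QZ_divisible (y c) n0))).
by rewrite natmulfctE.
Qed.

Definition inj_envelope : lmodType R := homZ R charZ.

Fact inj_embed_subproof (m : M) :
  (fun r : R => (fun c : {additive M -> QZ} => c (r *: m)) : charZ)
    \in @homZ_pred R charZ.
Proof.
by apply/asboolP => r s; apply/funext => c; rewrite scalerBl raddfB.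
Qed.
Definition inj_embed (m : M) : inj_envelope :=
  exist (fun g => g \in @homZ_pred R charZ) _ (inj_embed_subproof m).
Fact inj_embed_linear : linear inj_embed.
Proof.
move=> a u v; apply: homZ_ext => r; apply/funext => c.
by rewrite /= scalerDr scalerA raddfD.
Qed.
HB.instance Definition _ :=
  GRing.isLinear.Build R M inj_envelope *:%R inj_embed inj_embed_linear.

Lemma inj_embed_inj : injective inj_embed.
Proof.
move=> u v uv; apply: contrapT => nuv.
have [c cuv] : exists c : {additive M -> QZ}, c (u - v) <> 0.
  by apply: QZ_separates => /eqP; rewrite subr_eq0 => /eqP.
apply: cuv; have /(congr1 (fun f : inj_envelope => val f 1 c)) /= := uv.
by rewrite !scale1r raddfB => ->; rewrite subrr.
Qed.

Lemma inj_envelope_injective : injective_mod inj_envelope.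
Proof. exact: homZ_injective charZ_divisible. Qed.

End InjectiveHull.

Section Resolution.
Variables (R : comNzRingType) (M : lmodType R).

(* C_0 = M and C_(n+1) = E_n / C_n, where E_n is the injective module
   [inj_envelope C_n]; the differential is E_n -> C_(n+1) -> E_(n+1). *)
Definition cosyzygy_step (C : lmodType R) : lmodType R :=
  quot_mod (im_submod (@inj_embed R C) (full_submod C)).
Definition cosyzygy n : lmodType R := iter n cosyzygy_step M.

Definition std_res_d n :
    {linear inj_envelope (cosyzygy n) -> inj_envelope (cosyzygy n.+1)} :=
  @inj_embed R (cosyzygy n.+1) \o
    @quot_pi R _ (im_submod (@inj_embed R (cosyzygy n)) (full_submod _)).

Lemma std_res_dP n e :
  std_res_d n e = 0 <-> exists u, @inj_embed R (cosyzygy n) u = e.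
Proof.
split=> [|[u <-]].
  rewrite /= -(linear0 (@inj_embed R (cosyzygy n.+1))) => /inj_embed_inj /eqP.
  rewrite -(linear0 (@quot_pi R _ _)) quot_piE subr0 => /asboolP[u _ <-].
  by exists u.
rewrite /= [X in inj_embed X](_ : _ = 0) ?linear0 //.
apply/eqP; rewrite -(linear0 (@quot_pi R _ _)) quot_piE subr0.
by apply/asboolP; exists u.
Qed.

Lemma std_res_exact n e :
  std_res_d n.+1 e = 0 <-> exists u, std_res_d n u = e.
Proof.
rewrite std_res_dP; split=> [[u <-]|[u <-]].
  by exists (quot_repr u); rewrite /= quot_reprK.
by exists (quot_pi _ u).
Qed.

Definition std_resolution : inj_resolution M :=
  @InjResolution R M (fun n => inj_envelope (cosyzygy n)) std_res_d
    (@inj_embed R M) (fun n => @inj_envelope_injective R (cosyzygy n))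
    (@inj_embed_inj R M) (@std_res_dP 0) std_res_exact.

End Resolution.

Section LocalCohomology.
Variable R : comNzRingType.
Implicit Types (I J : submodule R^o) (M : lmodType R).

Definition span_pred (A : set R) : {pred R^o} :=
  fun a => `[< forall J, (forall b, A b -> b \in J) -> a \in J >].
Fact span_submod_closed A : GRing.submod_closed (span_pred A).
Proof.
split=> [|a u v /asboolP Au /asboolP Av]; apply/asboolP => J AJ.
  exact: rpred0.
by rewrite rpredD ?rpredZ ?Au ?Av.
Qed.
Definition ideal_span (A : set R) : submodule R^o :=
  Submodule (span_submod_closed A).

Definition ideal_mul I J : submodule R^o :=
  ideal_span (fun c => exists a b, [/\ a \in I, b \in J & c = a * b]).
Definition ideal_pow I (n : nat) : submodule R^o :=
  iter n (ideal_mul I) (full_submod R^o).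

Lemma ideal_pow_anti I n : {subset ideal_pow I n.+1 <= ideal_pow I n}.
Proof.
move=> a /asboolP; apply=> c [s [t [_ tI ->]]].
exact: (@rpredZ _ R^o _ s t tI).
Qed.

Lemma ideal_pow_le I m n : (m <= n)%N -> {subset ideal_pow I n <= ideal_pow I m}.
Proof.
move=> /subnK <-; elim: (n - m)%N => // k IHk a.
by rewrite addSn => /ideal_pow_anti /IHk.
Qed.

Definition torsion_pred I M : {pred M} :=
  fun u => `[< exists n, forall a, a \in ideal_pow I n -> a *: u = 0 >].
Fact torsion_submod_closed I M : GRing.submod_closed (@torsion_pred I M).
Proof.
split=> [|a u v /asboolP[n nu] /asboolP[k kv]]; apply/asboolP.
  by exists 0%N => a _; rewrite scaler0.
exists (maxn n k) => b bI; rewrite scalerDr scalerA mulrC -scalerA.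
rewrite nu ?kv ?scaler0 ?addr0 //; apply: ideal_pow_le bI.
  exact: leq_maxr.
exact: leq_maxl.
Qed.
Definition torsion I M : submodule M := Submodule (@torsion_submod_closed I M).

Section Cohomology.
Variables (I : submodule R^o) (M : lmodType R) (E : inj_resolution M).

Definition torsion_cocycles (i : nat) : submodule (res_obj E i) :=
  cap_submod (torsion I (res_obj E i)) (preim_submod (res_d E i) (zero_submod _)).

Definition torsion_cobounds (i : nat) : submodule (res_obj E i) :=
  match i return submodule (res_obj E i) with
  | 0 => zero_submod _
  | j.+1 => im_submod (res_d E j) (torsion I (res_obj E j))
  end.

Definition torsion_cohomology (i : nat) : lmodType R :=
  subquot (torsion_cocycles i) (torsion_cobounds i).

End Cohomology.

(* [is_local_cohomology I i M H] says that [H] is isomorphic to the value at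
   [M] of the i-th right derived functor of the I-torsion functor. Injective
   resolutions exist by [std_resolution]. *)
Definition is_local_cohomology I (i : nat) M (H : lmodType R) :=
  forall E : inj_resolution M, lmod_iso (torsion_cohomology I E i) H.

End LocalCohomology.

(* Main.v *)
From HB Require Import structures.
From Pilot Require Import Defs.
From mathcomp Require Import all_boot all_order all_algebra.
From mathcomp Require Import boolp classical_sets functions.

Set Implicit Arguments.
Unset Strict Implicit.
Unset Printing Implicit Defensive.

Import GRing.Theory.
Local Open Scope ring_scope.

(** Write x = (x_1, ..., x_d). The theorem is a chain of d dimension shifts
    that starts from the trivial case H^0(X) = X, followed by the
    identification of the last module in the chain with the local homology.

    Shifts. For a list s, let L(s) be the module of sequences (u_n) with u_n
    in 0 :_X s^(n+1) and (prod s) u_(n+1) = u_n, where s^k lists the k-th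
    powers of the entries of s. For a further element b, let T be the module
    of sequences with u_n still in 0 :_X s^(n+1), but with
    b (prod s) u_(n+1) = u_n. Sending (u_n) to (b^(n+1) u_n) gives an exact
    sequence 0 -> L(b :: s) -> T -> L(s) -> 0. Multiplication by b is bijective
    on T, so T has no local cohomology with respect to an ideal that contains
    b, and the connecting maps H^j(L(s)) -> H^(j+1)(L(b :: s)) are isomorphisms
    ([local_cohomology_shift]). Now L([::]) is X, which is torsion for the
    ideal of x because each element of m is locally nilpotent on an Artinian
    module, and L(x) is the top local homology ([local_homology_top]).

    Surjectivity of T -> L(s) is where coregularity enters: the fibres are
    inverse limits of cosets in X, they are nonempty at each level if b^(n+1)
    is surjective on 0 :_X s^(n+1), and then an inverse limit of cosets in an
    Artinian module is nonempty ([artinian_inverse_limit]).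

    Coregularity of x^(n+1) ([parameters_coregular_rev]) goes through Koszul
    homology. Let a be an element of m. A power of a kills 0 :_X x, which is
    the top Koszul homology, and a Fitting argument shows that a power of a
    kills the whole Koszul homology ([koszul_homology_nilpotent]). If moreover
    a is the first term of a coregular sequence, a short exact sequence of the
    form 0 -> 0 :_X a^N -> X -> X -> 0 and induction on the coregular sequence
    show that the Koszul homology vanishes in degrees less than the length of
    that sequence ([coregular_on_acyclic]). The co-Cohen-Macaulay hypothesis
    provides a coregular sequence of length d, so only the top homology
    survives, and this forces x, in reversed order, to be coregular
    ([acyclic_coregular_rev]). The same applies to x^(n+1).

    The local cohomology of T vanishes for a reason internal to injective
    resolutions: the inverse of b lifts to a resolution and is an inverse of
    b up to homotopy, whereas b is locally nilpotent on torsion elements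
    ([torsion_acyclic]). *)

(** * Choice principles *)

(** Builds lifts and homotopies one degree at a time: [P] is the invariant that
    makes the next choice possible, [Q] the equation between neighbours. *)
Lemma dependent_family (T : nat -> Type) (P : forall n, T n -> Prop)
    (Q : forall n, T n -> T n.+1 -> Prop) (x0 : T 0%N) :
  P 0%N x0 ->
  (forall n x, P n x -> exists2 y, P n.+1 y & Q n x y) ->
  exists2 f : forall n, T n, f 0%N = x0 & forall n, P n (f n) /\ Q n (f n) (f n.+1).
Proof.
move=> Px0 step; pose S n := {x : T n | P n x}.
have next n (x : S n) : {y : S n.+1 | Q n (sval x) (sval y)}.
  by case: (cid2 (step n _ (svalP x))) => y Py Qxy; exists (exist _ y Py).
pose f := fix f n : S n :=
  if n is k.+1 then sval (next k (f k)) else exist _ x0 Px0.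
exists (fun n => sval (f n)) => // n; split; first exact: svalP.
exact: (svalP (next n (f n))).
Qed.

Lemma bij_of_inj_surj (A B : Type) (f : A -> B) :
  injective f -> (forall b, exists a, f a = b) -> bijective f.
Proof.
move=> finj /choice[g gK]; exists g => // a.
by apply: finj; rewrite gK.
Qed.

(** * Local rings and Artinian modules *)

Section Cyclic.
Variables (R : comNzRingType) (X : lmodType R).

Definition orbit_map (v : X) (r : R^o) : X := (r : R) *: v.
Fact orbit_map_linear v : linear (orbit_map v).
Proof. by move=> a r s; rewrite /orbit_map scalerDl scalerA. Qed.
HB.instance Definition _ v :=
  GRing.isLinear.Build R R^o X *:%R (orbit_map v) (orbit_map_linear v).

Definition annihilator (v : X) : submodule R^o :=
  preim_submod (orbit_map v) (zero_submod X).

Lemma annihilatorE v r : (r \in annihilator v) = ((r : R) *: v == 0).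
Proof. by []. Qed.

End Cyclic.

Section LocalRing.
Variables (R : comNzRingType) (m : submodule R^o).
Hypothesis locR : local_ring m.

(** Otherwise no ideal above [J] is maximal, and choosing ever larger ones
    contradicts the chain condition. *)
Lemma proper_ideal_sub_maximal (J : submodule R^o) :
  (1 : R^o) \notin J -> {subset J <= m}.
Proof.
case: locR => noeth _ uniq J1 r rJ; apply: contrapT => nm.
pose P (I : submodule R^o) := (1 : R^o) \notin I /\ {subset J <= I}.
have [||F _ FP] := @dependent_family _ (fun _ => P)
    (fun _ I I' => {subset I <= I'} /\ ~ {subset I' <= I}) J.
- by split.
- move=> _ I [I1 JI]; apply: contrapT => maxI; apply: nm.
  rewrite -(uniq I); first exact: JI.
  split=> // I' II' I'1 s sI'; apply: contrapT => nsI; apply: maxI.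
  exists I'; first by split=> // t /JI /II'.
  by split=> // /(_ s sI').
have [n Fn] := noeth F (fun n => (FP n).2.1).
by have [_ [_]] := FP n; apply=> s; rewrite (Fn n.+1) ?leqnSn.
Qed.

(** The annihilator of a nonzero element of a simple module is a maximal ideal,
    hence is [m]. *)
Lemma simple_mod_scale0 (V : lmodType R) (a : R) (v : V) :
  simple_mod V -> a \in m -> a *: v = 0.
Proof.
move=> [_ simV] am; apply: contrapT => nav.
have v0 : v <> 0 by move=> v0; apply: nav; rewrite v0 scaler0.
have maxA : maximal_ideal (annihilator v).
  split; first by rewrite annihilatorE scale1r; apply/eqP.
  move=> J sJ J1 r rJ; have [S0|ST] := simV (im_submod (orbit_map v) J).
    have : (r : R) *: v \in im_submod (orbit_map v) J.
      by apply/asboolP; exists r.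
    by rewrite S0 annihilatorE.
  have : v \in im_submod (orbit_map v) J by rewrite ST.
  move=> /asboolP[s sJJ sv]; case/negP: J1.
  rewrite -(subrK s (1 : R^o)) rpredD // sJ // annihilatorE.
  by rewrite scalerBl scale1r [X in v - X]sv subrr.
apply: nav; apply/eqP; rewrite -annihilatorE.
by have [_ _ uniq] := locR; rewrite (uniq _ maxA).
Qed.

Lemma finite_length_nilpotent (V : lmodType R) (a : R) :
  finite_length V -> a \in m -> exists k, forall v : V, a ^+ k *: v = 0.
Proof.
move=> [l [F [F0 Fl Fs]]] am; exists l.
suff H i : (i <= l)%N -> forall v, v \in F i -> a ^+ i *: v = 0.
  by move=> v; apply: (H l) => //; rewrite Fl.
elim: i => [|i IH] il v vF; first by move: vF; rewrite F0 => /eqP->; rewrite scaler0.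
rewrite exprSr -scalerA; apply: (IH (ltnW il)).
have [_ sim] := Fs i il.
have := simple_mod_scale0 (quot_pi (preim_submod \val (F i))
  (exist (fun v => v \in F i.+1) v vF : submod_type (F i.+1))) sim am.
rewrite -linearZ -[RHS](linear0 (quot_pi _)) => /eqP; rewrite quot_piE subr0.
by [].
Qed.

(** If the submodules generated by [a^n u] stabilise, then [(1 - r a) a^n u = 0]
    for some [r], and [1 - r a] lies outside [m]. *)
Lemma artinian_locally_nilpotent (X : lmodType R) (a : R) (u : X) :
  artinian X -> a \in m -> exists n, a ^+ n *: u = 0.
Proof.
move=> art am.
pose F n := im_submod (orbit_map (a ^+ n *: u)) (full_submod R^o).
have [n Fn] : exists n, forall k, (n <= k)%N -> F k =i F n.
  apply: art => n v /asboolP[r _ <-]; apply/asboolP; exists ((r : R) * a : R) => //.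
  by rewrite /= /orbit_map exprS !scalerA mulrA.
exists n; apply: contrapT => /eqP nz.
have : a ^+ n *: u \in F n.+1.
  by rewrite Fn //; apply/asboolP; exists 1; rewrite //= /orbit_map scale1r.
move=> /asboolP[r _]; rewrite /= /orbit_map exprS -scalerA scalerA => ra.
have : (1 - r * a : R) \in m.
  apply: (@proper_ideal_sub_maximal (annihilator (a ^+ n *: u))).
    by rewrite annihilatorE scale1r.
  by rewrite annihilatorE scalerBl scale1r ra subrr.
move=> mra; have [_ [/negP m1 _] _] := locR; apply: m1.
rewrite -(subrK (r * a : R) (1 : R)) rpredD //.
exact: (@rpredZ _ R^o m r a am).
Qed.

End LocalRing.

(** * The Koszul complex as an iterated mapping cone *)

Section Koszul.
Variables (R : comNzRingType) (X : lmodType R).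
Implicit Types (S : submodule X) (y s : seq R) (a b c : R) (e k n : nat).

Definition ker_in S c : submodule X := cap_submod S (colon X [:: c]).
Definition im_in S c : submodule X := im_submod ( *:%R c) S.

Lemma ker_inP S c u : reflect (u \in S /\ c *: u = 0) (u \in ker_in S c).
Proof.
apply: (iffP andP) => [[uS /andP[/eqP]]|[uS /eqP cu]] //; split=> //.
by apply/andP.
Qed.

Lemma im_inP S c u : reflect (exists2 v, v \in S & c *: v = u) (u \in im_in S c).
Proof. exact: asboolP. Qed.

Lemma colon_cons b y u : (u \in colon X (b :: y)) = (b *: u == 0) && (u \in colon X y).
Proof. by []. Qed.

(** The Koszul complex, with all degrees together: the chains of [b :: y] are two
    copies of those of [y], the second one carrying the basis vector of [b]. The
    iterated cone makes every argument an induction on the sequence. *)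
Fixpoint kchain y : lmodType R :=
  if y is _ :: y' then GRing.Lmodule.clone R (kchain y' * kchain y')%type _ else X.
Arguments kchain : simpl never.

Definition kpair b y (u v : kchain y) : kchain (b :: y) := (u, v).

Lemma kchain_pairP b y (z : kchain (b :: y)) : exists u v : kchain y, z = kpair b u v.
Proof. by case: z => u v; exists u, v. Qed.

Lemma kpairD b y (u v u' v' : kchain y) :
  kpair b u v + kpair b u' v' = kpair b (u + u') (v + v').
Proof. by []. Qed.

Lemma kpairZ a b y (u v : kchain y) : a *: kpair b u v = kpair b (a *: u) (a *: v).
Proof. by []. Qed.

Lemma kpair_inj b y (u v u' v' : kchain y) :
  kpair b u v = kpair b u' v' -> u = u' /\ v = v'.
Proof. by case. Qed.

Fixpoint kdiff y : kchain y -> kchain y :=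
  match y return kchain y -> kchain y with
  | [::] => fun _ => 0
  | b :: y' => fun z => kpair b (kdiff z.1 + b *: z.2) (- kdiff z.2)
  end.
Arguments kdiff : simpl never.

Lemma kdiff_pair b y (u v : kchain y) :
  kdiff (kpair b u v) = kpair b (kdiff u + b *: v) (- kdiff v).
Proof. by []. Qed.

Fact kdiff_linear y : linear (@kdiff y).
Proof.
elim: y => [|b y IH] a u v; first by rewrite /kdiff scaler0 addr0.
have [u1 [u2 ->]] := kchain_pairP u; have [v1 [v2 ->]] := kchain_pairP v.
rewrite kpairZ kpairD !kdiff_pair !IH kpairZ kpairD; congr kpair.
  by rewrite !scalerDr !scalerA [b * a]mulrC addrACA.
by rewrite opprD scalerN.
Qed.
HB.instance Definition _ y :=
  GRing.isLinear.Build R (kchain y) (kchain y) *:%R (@kdiff y) (@kdiff_linear y).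

Lemma kdiffZ a y (u : kchain y) : kdiff (a *: u) = a *: kdiff u.
Proof. exact: linearZ. Qed.
Lemma kdiffD y (u v : kchain y) : kdiff (u + v) = kdiff u + kdiff v.
Proof. exact: linearD. Qed.
Lemma kdiffB y (u v : kchain y) : kdiff (u - v) = kdiff u - kdiff v.
Proof. exact: linearB. Qed.
Lemma kdiffN y (u : kchain y) : kdiff (- u) = - kdiff u.
Proof. exact: linearN. Qed.

Lemma kdiff_kdiff y (z : kchain y) : kdiff (kdiff z) = 0.
Proof.
elim: y z => [|b y IH] z //.
have [u [v ->]] := kchain_pairP z; rewrite !kdiff_pair kdiffD kdiffZ kdiffN scalerN !IH.
by rewrite add0r subrr !oppr0.
Qed.

Fixpoint chains_in_pred S y : kchain y -> bool :=
  match y return kchain y -> bool with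
  | [::] => fun u => u \in S
  | b :: y' => fun z => chains_in_pred S z.1 && chains_in_pred S z.2
  end.
Fact chains_in_closed S y : GRing.submod_closed (chains_in_pred S (y := y) : {pred _}).
Proof.
elim: y => [|b y [IH0 IHP]]; first exact: (submod_predP S).
split=> [|a u v]; first exact/andP.
have [u1 [u2 ->]] := kchain_pairP u; have [v1 [v2 ->]] := kchain_pairP v.
by move=> /andP[u1S u2S] /andP[v1S v2S]; apply/andP; split; apply: IHP.
Qed.
Definition chains_in S y := Submodule (chains_in_closed S y).

Lemma chains_in_pair S b y (u v : kchain y) :
  (kpair b u v \in chains_in S (b :: y))
  = (u \in chains_in S y) && (v \in chains_in S y).
Proof. by []. Qed.

Lemma chains_inS S S' y z :
  {subset S <= S'} -> z \in chains_in S y -> z \in chains_in S' y.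
Proof.
move=> sS; elim: y z => [|b y IH] z; first exact: sS.
by have [u [v ->]] := kchain_pairP z; rewrite !chains_in_pair => /andP[/IH -> /IH ->].
Qed.

Lemma chains_in_kdiff S y z : z \in chains_in S y -> kdiff z \in chains_in S y.
Proof.
elim: y z => [|b y IH] z; first by move=> _; apply: rpred0.
have [u [v ->]] := kchain_pairP z; rewrite kdiff_pair !chains_in_pair => /andP[uS vS].
by rewrite rpredD ?rpredN ?rpredZ ?IH.
Qed.

Lemma chains_in_ker S c y z :
  z \in chains_in S y -> c *: z = 0 -> z \in chains_in (ker_in S c) y.
Proof.
elim: y z => [|b y IH] z; first by move=> zS cz; apply/ker_inP.
have [u [v ->]] := kchain_pairP z; rewrite !chains_in_pair => /andP[uS vS].
by move=> /kpair_inj[cu cv]; rewrite !IH.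
Qed.

Lemma chains_in_ker0 S c y z : z \in chains_in (ker_in S c) y -> c *: z = 0.
Proof.
elim: y z => [|b y IH] z; first by move=> /ker_inP[].
have [u [v ->]] := kchain_pairP z; rewrite chains_in_pair => /andP[/IH cu /IH cv].
by congr pair.
Qed.

Lemma chains_in_im S c y z : z \in chains_in S y -> c *: z \in chains_in (im_in S c) y.
Proof.
elim: y z => [|b y IH] z; first by move=> zS; apply/im_inP; exists z.
have [u [v ->]] := kchain_pairP z; rewrite !chains_in_pair => /andP[/IH uS /IH vS].
exact/andP.
Qed.

(** A filtration by degree replaces the grading. In degree bound 0 the second
    component has bound [0.-1 = 0], which is right: it must vanish too. *)
Fixpoint deg_lt_pred e y : kchain y -> bool :=
  match y return kchain y -> bool with
  | [::] => fun u => (e == 0%N) ==> (u == 0)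
  | b :: y' => fun z => deg_lt_pred e z.1 && deg_lt_pred e.-1 z.2
  end.
Fact deg_lt_closed e y : GRing.submod_closed (deg_lt_pred e (y := y) : {pred _}).
Proof.
elim: y e => [|b y IH] e.
  split=> [|a u v]; rewrite !unfold_in /= ?eqxx ?implybT //.
  by case: e => //= /eqP-> /eqP->; rewrite scaler0 addr0.
have [[e0 eP] [f0 fP]] := (IH e, IH e.-1); split=> [|a u v]; first exact/andP.
have [u1 [u2 ->]] := kchain_pairP u; have [v1 [v2 ->]] := kchain_pairP v.
by move=> /andP[u1S u2S] /andP[v1S v2S]; apply/andP; split; [apply: eP|apply: fP].
Qed.
Definition deg_lt e y := Submodule (deg_lt_closed e y).

Lemma deg_lt_pair e b y (u v : kchain y) :
  (kpair b u v \in deg_lt e (b :: y))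
  = (u \in deg_lt e y) && (v \in deg_lt e.-1 y).
Proof. by []. Qed.

Lemma deg_lt0 y z : z \in deg_lt 0 y -> z = 0.
Proof.
elim: y z => [|b y IH] z; first by move/eqP.
by have [u [v ->]] := kchain_pairP z; rewrite deg_lt_pair => /andP[/IH -> /IH ->].
Qed.

Lemma deg_lt_kdiff e y z : z \in deg_lt e.+1 y -> kdiff z \in deg_lt e y.
Proof.
elim: y e z => [|b y IH] e z; first by rewrite rpred0.
have [u [v ->]] := kchain_pairP z; rewrite kdiff_pair !deg_lt_pair => /andP[ue ve].
rewrite rpredN rpredD ?rpredZ ?IH //.
by case: e ve {ue} => [/deg_lt0 ->|e ve]; first exact: rpred0.
Qed.

Lemma deg_ltS e y z : z \in deg_lt e y -> z \in deg_lt e.+1 y.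
Proof.
elim: y e z => [|b y IH] e z //.
have [u [v ->]] := kchain_pairP z; rewrite !deg_lt_pair => /andP[/IH ->].
by case: e => [/deg_lt0 ->|e /IH //]; apply: rpred0.
Qed.

Lemma deg_lt_full y z : z \in deg_lt (size y).+1 y.
Proof.
elim: y z => [|b y IH] z //.
by have [u [v ->]] := kchain_pairP z; rewrite deg_lt_pair IH andbT deg_ltS.
Qed.

(** Homogeneous components lift to homogeneous components because zero lifts
    to zero. *)
Lemma chains_in_im_lift S c y z : z \in chains_in (im_in S c) y ->
  exists w, [/\ w \in chains_in S y, c *: w = z &
    forall e, z \in deg_lt e y -> w \in deg_lt e y].
Proof.
elim: y z => [|b y IH] z.
  have [-> _|z0 /im_inP[v vS vz]] := eqVneq z 0.
    by exists 0; rewrite scaler0 !rpred0; split=> // e; rewrite rpred0.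
  exists v; split=> // -[|e] //.
  by move=> /deg_lt0 /eqP; rewrite (negPf z0).
have [u [v ->]] := kchain_pairP z; rewrite chains_in_pair.
move=> /andP[/IH[u' [uS uE ud]] /IH[v' [vS vE vd]]].
exists (kpair b u' v'); split; first by rewrite chains_in_pair uS.
  by rewrite -uE -vE.
by move=> e; rewrite !deg_lt_pair => /andP[/ud -> /vd ->].
Qed.

(** [b^n S] is the stable image of [b], on which [b] is surjective. *)
Lemma fitting S b : artinian X ->
  exists n, forall u, u \in im_in S (b ^+ n) ->
    exists2 v, v \in im_in S (b ^+ n) & b *: v = u.
Proof.
move=> art; have [n Fn] : exists n, forall k, (n <= k)%N ->
    im_in S (b ^+ k) =i im_in S (b ^+ n).
  apply: art => n u /im_inP[v vS <-]; apply/im_inP; exists (b *: v).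
    exact: rpredZ.
  by rewrite scalerA exprSr.
exists n => u; rewrite -(Fn n.+1) // => /im_inP[v vS <-].
exists (b ^+ n *: v); first by apply/im_inP; exists v.
by rewrite scalerA exprS.
Qed.

(** [b] acts nilpotently on [0 :_S (b^n, y)], with kernel inside [0 :_S (b, y)],
    so [n] applications of [a^k] suffice. *)
Lemma ker_pow_nilpotent S a b n k y :
  (forall u, u \in S -> u \in colon X (b :: y) -> a ^+ k *: u = 0) ->
  forall u, u \in ker_in S (b ^+ n) -> u \in colon X y -> a ^+ (k * n) *: u = 0.
Proof.
move=> ak; elim: n => [|n IH] u /ker_inP[uS bu] yu.
  by rewrite -[u]scale1r -(expr0 b) bu scaler0.
rewrite mulnS exprD -scalerA; apply: ak; first exact: rpredZ.
rewrite colon_cons [X in _ && X](rpredZ _ yu) andbT scalerA mulrC -scalerA; apply/eqP.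
apply: IH; last exact: rpredZ.
by apply/ker_inP; split; [apply: rpredZ | rewrite scalerA -exprSr].
Qed.

(** Rigidity: if a power of [a] kills the top Koszul homology, a power of [a] kills
    all of it. By induction on the sequence [b :: y], the stable image [Y] and
    the kernel [K] of [b^n] fit in [0 -> K -> S -> Y -> 0]. On [K] the induction
    hypothesis applies to [y] itself, as [b] is nilpotent there. On [Y] the
    element [b] is surjective, so that the homology of [b :: y] on [Y] is that of
    [y] on [0 :_Y b], to which the induction hypothesis also applies. *)
Lemma koszul_homology_nilpotent a : artinian X -> forall y S k,
  (forall u, u \in S -> u \in colon X y -> a ^+ k *: u = 0) ->
  exists N, forall z, z \in chains_in S y -> kdiff z = 0 ->
    exists2 w, w \in chains_in S y & kdiff w = a ^+ N *: z.
Proof.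
move=> art; elim=> [|b y IH] S k ak.
  exists k => z zS _; exists 0; first exact: rpred0.
  by rewrite linear0 ak.
have [n Yb] := fitting S b art.
set K := ker_in S (b ^+ n); set Y := im_in S (b ^+ n) in Yb *.
have [N1 H1] := IH K _ (ker_pow_nilpotent (n := n) ak).
have KS : {subset K <= S} by move=> u /ker_inP[].
have YS : {subset Y <= S} by move=> _ /im_inP[v vS <-]; apply: rpredZ.
have [N2 H2] : exists N, forall z, z \in chains_in (ker_in Y b) y -> kdiff z = 0 ->
    exists2 w, w \in chains_in (ker_in Y b) y & kdiff w = a ^+ N *: z.
  apply: (IH _ k) => u /ker_inP[/YS uS bu] yu.
  by apply: ak; rewrite // colon_cons bu eqxx.
(* The homology of the cone is an extension of a submodule by a quotient of
   that of y, both killed by a^N1. *)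
have {}H1 z : z \in chains_in K (b :: y) -> kdiff z = 0 ->
    exists2 w, w \in chains_in K (b :: y) & kdiff w = a ^+ (N1 + N1) *: z.
  have [u [v ->]] := kchain_pairP z; rewrite chains_in_pair kdiff_pair.
  move=> /andP[uK vK] /kpair_inj[du dv].
  have {}dv : kdiff v = 0 by apply/eqP; rewrite -oppr_eq0 dv.
  have [v' v'K dv'] := H1 v vK dv.
  have [||u' u'K du'] := H1 (a ^+ N1 *: u + b *: v').
  - by rewrite rpredD ?rpredZ.
  - by rewrite kdiffD !kdiffZ dv' scalerA mulrC -scalerA -scalerDr du scaler0.
  exists (kpair b u' (- (a ^+ N1 *: v'))).
    by rewrite chains_in_pair u'K rpredN rpredZ.
  rewrite kdiff_pair; congr pair.
    rewrite du' scalerDr scalerA -exprD scalerN !scalerA [b * _]mulrC.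
    by rewrite addrK.
  by rewrite kdiffN opprK kdiffZ dv' scalerA -exprD.
(* Writing u = b p, subtracting the boundary of (0, p) from the cycle (u, v)
   leaves (0, v + d p), and v + d p is a cycle killed by b. *)
have {}H2 z : z \in chains_in Y (b :: y) -> kdiff z = 0 ->
    exists2 w, w \in chains_in Y (b :: y) & kdiff w = a ^+ N2 *: z.
  have [u [v ->]] := kchain_pairP z; rewrite chains_in_pair kdiff_pair.
  move=> /andP[uY vY] /kpair_inj[du dv].
  have {}dv : kdiff v = 0 by apply/eqP; rewrite -oppr_eq0 dv.
  have uY' : u \in chains_in (im_in Y b) y.
    by apply: chains_inS uY => t /Yb[v' v'Y <-]; apply/im_inP; exists v'.
  have [p [pY pE _]] := chains_in_im_lift uY'.
  have vpY : v + kdiff p \in chains_in (ker_in Y b) y.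
    apply: chains_in_ker; first by rewrite rpredD ?chains_in_kdiff.
    by rewrite scalerDr addrC -kdiffZ pE.
  have [|q qK dq] := H2 _ vpY; first by rewrite kdiffD dv kdiff_kdiff addr0.
  exists (kpair b 0 (a ^+ N2 *: p - q)).
    rewrite chains_in_pair rpred0 rpredB ?rpredZ //.
    by apply: chains_inS qK => t /ker_inP[].
  rewrite kdiff_pair linear0 add0r kpairZ; congr kpair.
    by rewrite scalerBr (chains_in_ker0 qK) subr0 -pE !scalerA mulrC.
  by rewrite kdiffB kdiffZ dq scalerDr opprB addrK.
exists (N1 + N1 + N2)%N => z zS dz.
have [||w wY dw] := H2 (b ^+ n *: z); first exact: chains_in_im.
  by rewrite kdiffZ dz scaler0.
have [w' [w'S wE _]] := chains_in_im_lift wY.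
have [||q qK dq] := H1 (a ^+ N2 *: z - kdiff w').
- apply: chains_in_ker; first by rewrite rpredB ?rpredZ ?chains_in_kdiff.
  by rewrite scalerBr -kdiffZ wE dw !scalerA mulrC subrr.
- by rewrite kdiffB kdiffZ dz scaler0 kdiff_kdiff subr0.
exists (q + a ^+ (N1 + N1) *: w').
  by rewrite rpredD ?rpredZ // (chains_inS KS).
by rewrite kdiffD kdiffZ dq scalerBr subrK scalerA -exprD.
Qed.
End Koszul.
Arguments kchain : simpl never.
Arguments kdiff : simpl never.

(** * Systems of parameters of co-Cohen-Macaulay modules are coregular *)

Section Coregular.
Variables (R : comNzRingType) (X : lmodType R).
Implicit Types (S : submodule X) (y s : seq R) (a b c : R) (e k n N : nat).

Definition surj_on S a := forall u, u \in S -> exists2 v, v \in S & a *: v = u.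

Fixpoint coregular_on S s : Prop :=
  if s is a :: s' then surj_on S a /\ coregular_on (ker_in S a) s' else True.

(** Coregularity of the reversed sequence, with the surjectivity conditions
    exposed one entry at a time. *)
Fixpoint coregular_rev y : Prop :=
  if y is b :: y' then surj_on (colon X y') b /\ coregular_rev y' else True.

Lemma surj_on_pow S a N : surj_on S a -> surj_on S (a ^+ N).
Proof.
move=> sa; elim: N => [|N IH] u uS; first by exists u; rewrite ?scale1r.
have [v vS <-] := sa u uS; have [w wS <-] := IH v vS.
by exists w; rewrite // scalerA -exprS.
Qed.

Lemma coregular_on_ext S S' s : S =i S' -> coregular_on S s -> coregular_on S' s.
Proof.
elim: s S S' => [|a s IH] S S' eS //= [sa cs]; split.
  by move=> u; rewrite -eS => /sa[v vS <-]; exists v; rewrite -?eS.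
apply: IH cs => u.
by apply/ker_inP/ker_inP; rewrite eS.
Qed.

Lemma coregular_on_full s : coregular X s -> coregular_on (full_submod X) s.
Proof.
have H S : (forall i, (i < size s)%N -> forall u, u \in S ->
    u \in colon X (take i s) ->
    exists v, [/\ v \in S, v \in colon X (take i s) & s`_i *: v = u]) ->
  coregular_on S s.
  elim: s S => [|a s IH] S H //=; split.
    move=> u uS; have [|v [vS _ <-]] := H 0%N isT u uS; first by rewrite take0.
    by exists v.
  apply: IH => i il u /ker_inP[uS au] ut.
  have [|v [vS]] := H i.+1 il u uS; first by rewrite /= colon_cons au eqxx.
  rewrite /= colon_cons => /andP[/eqP av vt] vu.
  by exists v; split=> //; apply/ker_inP.
by move=> cs; apply: H => i il u _ /(cs i il)[v vt <-]; exists v.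
Qed.

(** [0 :_S a^(N+1)] is an extension of [0 :_S a^N] by [0 :_S a] because
    multiplication by [a] is surjective on [S]. *)
Lemma coregular_on_pow S a s N : surj_on S a ->
  coregular_on (ker_in S a) s -> coregular_on (ker_in S (a ^+ N)) s.
Proof.
elim: s S => [|c s IH] S sa //= [sc cs]; split.
  elim: N {IH} => [|N IHN] u /ker_inP[uS au].
    exists 0; first exact: rpred0.
    by rewrite -[u]scale1r -(expr0 a) au scaler0.
  have [|v vK cv] := sc (a ^+ N *: u).
    apply/ker_inP; split; first exact: rpredZ.
    by rewrite scalerA -exprS.
  have [vS av] := ker_inP _ _ _ vK.
  have [w wS wv] := surj_on_pow N sa vS.
  have [|w' /ker_inP[w'S aw'] cw'] := IHN (u - c *: w).
    apply/ker_inP; split; first by rewrite rpredB ?rpredZ.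
    by rewrite scalerBr -cv -wv !scalerA mulrC subrr.
  exists (w + w'); last by rewrite scalerDr cw' addrC subrK.
  apply/ker_inP; split; first exact: rpredD.
  by rewrite exprS -scalerA scalerDr aw' addr0 wv.
apply: (@coregular_on_ext (ker_in (ker_in S c) (a ^+ N))).
  by move=> u; apply/ker_inP/ker_inP => -[/ker_inP[uS ?] ?]; split=> //; apply/ker_inP.
apply: IH.
  move=> u /ker_inP[uS cu]; have [v vS vu] := sa u uS.
  have [|v' /ker_inP[v'S av'] cv'] := sc (c *: v).
    apply/ker_inP; split; first exact: rpredZ.
    by rewrite scalerA mulrC -scalerA vu.
  exists (v - v'); last by rewrite scalerBr av' subr0.
  by apply/ker_inP; rewrite rpredB // scalerBr cv' subrr.
apply: coregular_on_ext cs.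
by move=> u; apply/ker_inP/ker_inP => -[/ker_inP[uS ?] ?]; split=> //; apply/ker_inP.
Qed.

(** For a coregular sequence [a :: s], a cycle [z] of degree at most [size s] equals
    [a^N w] with [w] of the same degree. Then [d w] is a cycle of lower degree on
    [0 :_S a^N], where [s] is coregular, so [d w = d v] with [a^N v = 0]; thus
    [z = a^N (w - v)] is [a^N] times a cycle, and [a^N] kills homology. *)
Lemma coregular_on_acyclic y s S : artinian X ->
  (forall a, a \in s -> exists k, forall u, u \in colon X y -> a ^+ k *: u = 0) ->
  coregular_on S s ->
  forall z, z \in chains_in S y -> z \in deg_lt X (size s) y -> kdiff z = 0 ->
    exists2 w, w \in chains_in S y & kdiff w = z.
Proof.
move=> art; elim: s S => [|a s IH] S nil.
  move=> _ z _ /deg_lt0 -> _; exists 0; [exact: rpred0 | exact: linear0].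
move=> [sa cs] z zS zd dz.
have [k ak] := nil a (mem_head a s).
have [N HN] := koszul_homology_nilpotent art (S := S) (fun u _ => ak u).
have zim : z \in chains_in (im_in S (a ^+ N)) y.
  by apply: chains_inS zS => u /(surj_on_pow N sa)[v vS <-]; apply/im_inP; exists v.
have [w [wS wz wd]] := chains_in_im_lift zim.
have [||||v vK dv] := IH (ker_in S (a ^+ N)) _ (coregular_on_pow N sa cs) (kdiff w).
- by move=> b bs; apply: nil; rewrite inE bs orbT.
- by apply: chains_in_ker; rewrite ?chains_in_kdiff // -kdiffZ wz.
- exact/deg_lt_kdiff/wd.
- exact: kdiff_kdiff.
have [||w' w'S dw'] := HN (w - v); last first.
- by exists w'; rewrite // dw' scalerBr wz (chains_in_ker0 vK) subr0.
- by rewrite kdiffB dv subrr.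
by rewrite rpredB //; apply: chains_inS vK => t /ker_inP[].
Qed.


Lemma chains_in_full y z : z \in chains_in (full_submod X) y.
Proof.
elim: y z => [|b y IH] z //.
by have [u [v ->]] := kchain_pairP z; rewrite chains_in_pair !IH.
Qed.

(** The coefficient of the product of all the basis vectors. *)
Fixpoint top_coef y : kchain X y -> X :=
  match y return kchain X y -> X with
  | [::] => id
  | b :: y' => fun z => top_coef z.2
  end.

Fixpoint top_chain y (u : X) : kchain X y :=
  match y return kchain X y with
  | [::] => u
  | b :: y' => kpair b 0 (top_chain y' u)
  end.

Lemma top_coef_pair b y (u v : kchain X y) : top_coef (kpair b u v) = top_coef v.
Proof. by []. Qed.

Lemma top_coefP y a (u v : kchain X y) :
  top_coef (a *: u + v) = a *: top_coef u + top_coef v.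
Proof.
elim: y u v => [|b y IH] u v //.
have [u1 [u2 ->]] := kchain_pairP u; have [v1 [v2 ->]] := kchain_pairP v.
by rewrite kpairZ kpairD !top_coef_pair IH.
Qed.

Lemma top_coef_kdiff y (z : kchain X y) : top_coef (kdiff z) = 0.
Proof.
elim: y z => [|b y IH] z //; have [u [v ->]] := kchain_pairP z.
by rewrite kdiff_pair top_coef_pair -kdiffN IH.
Qed.

Lemma top_coef_cycle y (z : kchain X y) : kdiff z = 0 -> top_coef z \in colon X y.
Proof.
elim: y z => [|b y IH] z //; have [u [v ->]] := kchain_pairP z.
rewrite kdiff_pair top_coef_pair => /kpair_inj[duv dv].
rewrite colon_cons IH ?andbT; last by apply/eqP; rewrite -oppr_eq0 dv.
have := top_coefP b v (kdiff u).
rewrite top_coef_kdiff addr0 addrC duv -[X in top_coef X](linear0 (@kdiff R X y)).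
by rewrite top_coef_kdiff => <-.
Qed.

Lemma top_chainK y u : top_coef (top_chain y u) = u.
Proof. by elim: y. Qed.

Lemma top_chain_cycle y u : u \in colon X y -> kdiff (top_chain y u) = 0.
Proof.
elim: y => [|b y IH] //; rewrite colon_cons => /andP[/eqP bu /IH ku].
rewrite kdiff_pair linear0 add0r ku oppr0; congr kpair.
elim: (y) => [|c y' IH'] //=; rewrite kpairZ scaler0 IH' //.
Qed.

(** From the long exact sequence of the cone, [b] is injective on the homology of
    [y] in degrees less than [size y]; as it is also locally nilpotent there, that
    homology vanishes. In degree [size y], [b] is surjective on the homology of
    [y], which is [0 :_X y]. *)
Lemma acyclic_coregular_rev y :
  (forall b u, b \in y -> exists n, b ^+ n *: u = 0 :> X) ->
  (forall z, z \in deg_lt X (size y) y -> kdiff z = 0 -> exists w, kdiff w = z) ->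
  coregular_rev y.
Proof.
elim: y => [|b y IH] // nil ac.
have knil (z : kchain X y) : exists n, b ^+ n *: z = 0.
  elim: (y) z => [|c y' IHy] z; first exact: (nil b z (mem_head b y)).
  have [u [v ->]] := kchain_pairP z; have [[k ku] [l lv]] := (IHy u, IHy v).
  exists (k + l)%N; rewrite kpairZ exprD -[in X in kpair _ _ X]scalerA lv scaler0.
  by rewrite mulrC -scalerA ku scaler0.
split.
  move=> u uy; have [||w] := ac (kpair b (top_chain y u) 0).
  - by rewrite deg_lt_pair deg_lt_full rpred0.
  - by rewrite kdiff_pair top_chain_cycle // scaler0 addr0 linear0 oppr0.
  have [p [q ->]] := kchain_pairP w; rewrite kdiff_pair => /kpair_inj[pq dq].
  have {}dq : kdiff q = 0 by apply/eqP; rewrite -oppr_eq0 dq.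
  exists (top_coef q); first exact: top_coef_cycle.
  by rewrite -(top_chainK y u) -pq addrC top_coefP top_coef_kdiff addr0.
apply: IH => [c u cy|z zd dz]; first by apply: nil; rewrite inE cy orbT.
(* There is no b-torsion in homology: a chain w with d w = b t makes the
   pair (- w, t) a cycle of the cone. *)
have step t : t \in deg_lt X (size y) y -> kdiff t = 0 ->
    (exists w, kdiff w = b *: t) -> exists w, kdiff w = t.
  move=> td dt [w dw]; have [||w'] := ac (kpair b (- w) t).
  - by rewrite deg_lt_pair deg_lt_full.
  - by rewrite kdiff_pair kdiffN dw addNr dt oppr0.
  have [p [q ->]] := kchain_pairP w'; rewrite kdiff_pair => /kpair_inj[_ dq].
  by exists (- q); rewrite kdiffN.
have [n] := knil z; elim: n => [|n IHn] bz.
  by exists 0; rewrite linear0 -bz scale1r.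
suff H : exists w, kdiff w = b ^+ n *: z.
  elim: n {IHn bz} H => [|n IHn] H; first by rewrite scale1r in H.
  apply: IHn; apply: step; rewrite ?rpredZ ?kdiffZ ?dz ?scaler0 //.
  by rewrite scalerA -exprS.
apply: step; rewrite ?rpredZ ?kdiffZ ?dz ?scaler0 //.
by exists 0; rewrite linear0 scalerA -exprS bz.
Qed.

(** Powers of a system of parameters form a system of parameters. *)
Lemma colon_pow_nilpotent y S a k n :
  (forall u, u \in S -> u \in colon X y -> a ^+ k *: u = 0) ->
  exists k', forall u, u \in S -> u \in colon X [seq b ^+ n | b <- y] ->
    a ^+ k' *: u = 0.
Proof.
elim: y S k => [|b y IH] S k ak; first by exists k.
have [k' ak'] := IH _ _ (ker_pow_nilpotent (n := n) ak).
exists k' => u uS; rewrite /= colon_cons => /andP[/eqP bu uy].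
by apply: ak' => //; apply/ker_inP.
Qed.

Theorem parameters_coregular_rev (m : submodule R^o) s x n :
  local_ring m -> artinian X -> {subset s <= m} -> {subset x <= m} ->
  coregular X s -> size s = size x -> finite_length (submod_type (colon X x)) ->
  coregular_rev [seq b ^+ n.+1 | b <- x].
Proof.
move=> locR art sm xm cs ssx fl; apply: acyclic_coregular_rev.
  move=> _ u /mapP[b bx ->].
  have [k bk] := artinian_locally_nilpotent locR u art (xm b bx).
  by exists k; rewrite -exprM mulSn addnC exprD -scalerA bk scaler0.
rewrite size_map -ssx => z zd dz.
have [|w _ <-] := coregular_on_acyclic art _ (coregular_on_full cs)
  (chains_in_full z) zd dz;
  last by exists w.
  move=> a /sm am; have [k ak] := finite_length_nilpotent locR fl am.
  have [|k' ak'] := @colon_pow_nilpotent x (full_submod X) a k n.+1.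
    move=> u _ ux.
    have /(congr1 val) := ak (exist (fun v => v \in colon X x) u ux).
    by rewrite linearZ.
  by exists k' => u; apply: ak'.
Qed.

End Coregular.

(** * Injective resolutions *)

Section Injective.
Variable R : comNzRingType.

Lemma linear_eq0_inj (U V : lmodType R) (f : {linear U -> V}) :
  (forall u, f u = 0 -> u = 0) -> injective f.
Proof.
move=> f0 u v /eqP; rewrite -subr_eq0 -linearB => /eqP/f0/eqP.
by rewrite subr_eq0 => /eqP.
Qed.

(** Injectivity for maps [u] that are not injective, applied below to the
    differentials of a resolution. *)
Lemma injective_extend (A B E : lmodType R) (u : {linear A -> B})
    (g : {linear A -> E}) :
  injective_mod E -> (forall a, u a = 0 -> g a = 0) ->
  exists h : {linear B -> E}, forall a, h (u a) = g a.
Proof.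
move=> injE ker; pose I := im_submod u (full_submod A).
have gE a a' : u a = u a' -> g a = g a'.
  move=> /eqP; rewrite -subr_eq0 -linearB => /eqP/ker/eqP.
  by rewrite linearB subr_eq0 => /eqP.
have pre (w : submod_type I) : {a | u a = val w}.
  by apply: cid; have /asboolP[a _ ua] := valP w; exists a.
pose k w := g (sval (pre w)).
have kL : linear k.
  move=> a v w; rewrite /k -linearP; apply: gE.
  by rewrite linearP !(svalP (pre _)) linearP.
pose kl : {linear submod_type I -> E} :=
  HB.pack k (GRing.isLinear.Build R (submod_type I) E *:%R k kL).
have [h hE] := injE _ _ (\val : {linear submod_type I -> B}) kl val_inj.
exists h => a; have uI : u a \in I by apply/asboolP; exists a.
rewrite (hE (exist (fun v => v \in I) (u a) uI)); apply: gE.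
by rewrite (svalP (pre _)).
Qed.

Lemma injective_mod_prod (E F : lmodType R) :
  injective_mod E -> injective_mod F ->
  injective_mod (E * F)%type.
Proof.
move=> injE injF A B f g finj.
have [h hE] := injE A B f (fst \o g) finj.
have [k kE] := injF A B f (snd \o g) finj.
pose hk b := (h b, k b).
have hkL : linear hk by move=> a u v; rewrite /hk !linearP.
exists (HB.pack hk (GRing.isLinear.Build R B (E * F)%type *:%R hk hkL)
  : {linear B -> (E * F)%type}) => a /=.
by rewrite /hk hE kE /=; case: (g a).
Qed.

Lemma res_dd (M : lmodType R) (E : inj_resolution M) n e :
  res_d E n.+1 (res_d E n e) = 0.
Proof. by apply/res_exact; exists e. Qed.

Lemma res_d_aug (M : lmodType R) (E : inj_resolution M) u :
  res_d E 0 (res_aug E u) = 0.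
Proof. by apply/res_exact0; exists u. Qed.

Lemma resolution_lift (M : lmodType R) (f : {linear M -> M})
    (E : inj_resolution M) :
  exists2 phi : forall n, {linear res_obj E n -> res_obj E n},
    forall u, phi 0%N (res_aug E u) = res_aug E (f u) &
    forall n e, phi n.+1 (res_d E n e) = res_d E n (phi n e).
Proof.
have [|phi0 phi0E] := @injective_extend _ _ _ (res_aug E) (res_aug E \o f)
  (@res_inj _ _ E 0%N).
  move=> u; rewrite -(linear0 (res_aug E)) => /res_aug_inj ->.
  by rewrite /= !linear0.
have [||phi phi0' phiP] := @dependent_family
  (fun n => {linear res_obj E n -> res_obj E n})
  (fun n phi => forall e, res_d E n e = 0 -> res_d E n (phi e) = 0)
  (fun n phi phi' => forall e, phi' (res_d E n e) = res_d E n (phi e)) phi0.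
- by move=> _ /res_exact0[u <-]; rewrite phi0E /= res_d_aug.
- move=> n phi Pphi.
  have [phi' phi'E] := @injective_extend _ _ _ (res_d E n) (res_d E n \o phi)
    (@res_inj _ _ E n.+1) Pphi.
  exists phi' => // _ /res_exact[e <-].
  by rewrite phi'E /= res_dd.
exists phi => [u|n]; last exact: (phiP n).2.
by rewrite phi0' phi0E.
Qed.

Lemma resolution_homotopy (M : lmodType R) (E : inj_resolution M)
    (phi : forall n, {linear res_obj E n -> res_obj E n}) :
  (forall u, phi 0%N (res_aug E u) = 0) ->
  (forall n e, phi n.+1 (res_d E n e) = res_d E n (phi n e)) ->
  exists s : forall n, {linear res_obj E n.+1 -> res_obj E n},
    forall n e, phi n.+1 e = res_d E n (s n e) + s n.+1 (res_d E n.+1 e).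
Proof.
move=> phi0 phid.
have [|s0 s0E] := @injective_extend _ _ _ (res_d E 0) (phi 0%N)
  (@res_inj _ _ E 0%N).
  by move=> _ /res_exact0[u <-].
have [||s _ sP] := @dependent_family
  (fun n => {linear res_obj E n.+1 -> res_obj E n})
  (fun n s => forall e, phi n.+1 (res_d E n e) = res_d E n (s (res_d E n e)))
  (fun n s s' => forall e, phi n.+1 e = res_d E n (s e) + s' (res_d E n.+1 e)) s0.
- by move=> e; rewrite phid s0E.
- move=> n s Ps.
  have [|s' s'E] := @injective_extend _ _ _ (res_d E n.+1)
    (phi n.+1 \- (res_d E n \o s)) (@res_inj _ _ E n.+1).
    by move=> _ /res_exact[e <-] /=; rewrite Ps subrr.
  exists s' => e; last by rewrite s'E /= addrC subrK.
  by rewrite phid s'E /= linearB res_dd subr0.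
by exists s => n e; rewrite (sP n).2.
Qed.

Lemma ideal_pow_expr (I : submodule R^o) (c : R) n :
  c \in I -> c ^+ n \in ideal_pow I n.
Proof.
move=> cI; elim: n => [|n IH] //; apply/asboolP => J; apply.
by exists c, (c ^+ n); rewrite exprS.
Qed.

Lemma torsion_linear (I : submodule R^o) (U V : lmodType R) (f : {linear U -> V}) u :
  u \in torsion I U -> f u \in torsion I V.
Proof.
move=> /asboolP[n nu]; apply/asboolP; exists n => a /nu au.
by rewrite -linearZ /= au linear0.
Qed.

Lemma torsion_pow (I : submodule R^o) (c : R) (U : lmodType R) u :
  c \in I -> u \in torsion I U -> exists n, c ^+ n *: u = 0.
Proof. by move=> cI /asboolP[n nu]; exists n; apply/nu/ideal_pow_expr. Qed.

Section Acyclic.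
Variables (I : submodule R^o) (T : lmodType R) (E : inj_resolution T) (c : R).
Hypotheses (cI : c \in I) (cinj : forall t : T, c *: t = 0 -> t = 0).
Hypothesis csurj : forall t : T, exists t', c *: t' = t.

Lemma torsion_acyclic0 z :
  z \in torsion I (res_obj E 0) -> res_d E 0 z = 0 -> z = 0.
Proof.
move=> tz /res_exact0[t tE]; have [n cz] := torsion_pow cI tz.
suff t0 : t = 0 by rewrite -tE t0 linear0.
move: cz; rewrite -tE -linearZ -(linear0 (res_aug E)) => /res_aug_inj.
elim: n => [|n IH]; first by rewrite scale1r.
by rewrite exprS -scalerA => /cinj.
Qed.

(** On each cohomology module of the torsion subcomplex, [c] is both
    invertible, its inverse being induced by a lift of [c^-1 : T -> T] to the
    resolution, and locally nilpotent. *)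
Lemma torsion_acyclic n z :
  z \in torsion I (res_obj E n.+1) -> res_d E n.+1 z = 0 ->
  exists2 w, w \in torsion I (res_obj E n) & res_d E n w = z.
Proof.
have [ci ciK] := choice csurj.
have ciL : linear ci.
  move=> a u v; apply/eqP; rewrite -subr_eq0; apply/eqP/cinj.
  by rewrite scalerBr scalerDr scalerA mulrC -scalerA !ciK subrr.
pose cil : {linear T -> T} := HB.pack ci (GRing.isLinear.Build R T T *:%R ci ciL).
have [gam gam0 gamd] := resolution_lift cil E.
have [||s sE] := @resolution_homotopy T E (fun n => idfun \- (c \*: gam n)).
- by move=> u; rewrite /= gam0 -linearZ /= ciK subrr.
- move=> k e; rewrite /= gamd [RHS]linearB; congr (_ - _).
  by rewrite [RHS]linearZ.
have step k e : res_d E k.+1 e = 0 -> e = c *: gam k.+1 e + res_d E k (s k e).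
  by move=> de; have /= := sE k e; rewrite de linear0 addr0 => <-; rewrite addrC subrK.
move=> tz dz; have [k ck] := torsion_pow cI tz.
elim: k z tz dz ck => [|k IH] z tz dz ck.
  exists 0; first exact: rpred0.
  by rewrite linear0 -[z]scale1r -(expr0 c) ck.
have [||| w wt dw] := IH (c *: gam n.+1 z).
- by rewrite rpredZ // torsion_linear.
- by rewrite linearZ /= -gamd dz linear0 scaler0.
- by rewrite scalerA -exprSr -linearZ /= ck linear0.
exists (w + s n z); first by rewrite rpredD // torsion_linear.
by rewrite linearD /= dw -step.
Qed.
End Acyclic.

End Injective.

(** * Dimension shifting for local cohomology *)

Section Horseshoe.
Variables (R : comNzRingType) (K T L : lmodType R).
Variables (i : {linear K -> T}) (p : {linear T -> L}).
Hypotheses (iinj : injective i) (psurj : forall l, exists t, p t = l).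
Hypothesis exT : forall t, p t = 0 <-> exists k, i k = t.
Variables (E : inj_resolution K) (F : inj_resolution L).

(** What is needed to make a resolution of [T] out of [E] and [F]: a map to [E_0]
    and the off-diagonal part of the differential, with the signs under which
    the sum of [E] and [F] becomes a complex. *)
Definition horseshoe_data (g : {linear T -> res_obj E 0})
    (th : forall n, {linear res_obj F n -> res_obj E n.+1}) :=
  [/\ forall k, g (i k) = res_aug E k,
      forall t, th 0%N (res_aug F (p t)) = - res_d E 0 (g t) &
      forall n f, th n.+1 (res_d F n f) = - res_d E n.+1 (th n f)].

(** Each [th_n] is found by injectivity of [E_(n+1)]; the anticommutation in degree
    [n] is what makes the next extension problem solvable. *)
Lemma horseshoe_exists : exists g th, horseshoe_data g th.
Proof.
have [g gE] := @res_inj _ _ E 0%N _ _ i (res_aug E) iinj.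
have [|th0 th0E] := @injective_extend _ _ _ _ (res_aug F \o p)
    (\- (res_d E 0 \o g)) (@res_inj _ _ E 1).
  move=> t /=; rewrite -(linear0 (res_aug F)) => /res_aug_inj /exT[k <-].
  by rewrite gE res_d_aug oppr0.
have [||th th0' thP] := @dependent_family
  (fun n => {linear res_obj F n -> res_obj E n.+1})
  (fun n th => forall f, res_d F n f = 0 -> res_d E n.+1 (th f) = 0)
  (fun n th th' => forall f, th' (res_d F n f) = - res_d E n.+1 (th f)) th0.
- move=> _ /res_exact0[l <-]; have [t <-] := psurj l.
  by have /= -> := th0E t; rewrite linearN res_dd oppr0.
- move=> n th Pth; have [|th' th'E] := @injective_extend _ _ _ _ (res_d F n)
    (\- (res_d E n.+1 \o th)) (@res_inj _ _ E n.+2).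
    by move=> f /Pth /= ->; rewrite oppr0.
  exists th' => [_ /res_exact[f <-]|f]; last exact: th'E.
  by rewrite th'E /= linearN res_dd oppr0.
exists g, th; split=> // [t|n]; last exact: (thP n).2.
by rewrite th0'; exact: th0E.
Qed.

Variables (g : {linear T -> res_obj E 0}).
Variable (th : forall n, {linear res_obj F n -> res_obj E n.+1}).
Hypothesis tw : horseshoe_data g th.

Definition twist_obj n : lmodType R := (res_obj E n * res_obj F n)%type.

Definition twist_d n (z : twist_obj n) : twist_obj n.+1 :=
  (res_d E n z.1 + th n z.2, res_d F n z.2).
Fact twist_d_linear n : linear (@twist_d n).
Proof.
move=> a [u1 u2] [v1 v2]; rewrite /twist_d /=; congr pair; last exact: linearP.
by rewrite (linearP (res_d E n)) (linearP (th n)) addrACA -scalerDr.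
Qed.
HB.instance Definition _ n :=
  GRing.isLinear.Build R (twist_obj n) (twist_obj n.+1) *:%R (@twist_d n)
    (@twist_d_linear n).

Definition twist_aug (t : T) : twist_obj 0 := (g t, res_aug F (p t)).
Fact twist_aug_linear : linear twist_aug.
Proof. by move=> a u v; rewrite /twist_aug !linearP. Qed.
HB.instance Definition _ :=
  GRing.isLinear.Build R T (twist_obj 0) *:%R twist_aug twist_aug_linear.

Fact twist_aug_inj : injective twist_aug.
Proof.
have [gi _ _] := tw; apply: linear_eq0_inj => t [gt].
rewrite -(linear0 (res_aug F)) => /res_aug_inj /exT[k tE].
move: gt; rewrite -tE gi -(linear0 (res_aug E)) => /res_aug_inj ->.
by rewrite linear0.
Qed.

Fact twist_exact0 e : twist_d e = 0 <-> exists u, twist_aug u = e.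
Proof.
have [gi th0 _] := tw; split=> [|[t <-]]; last first.
  by rewrite /twist_d /= th0 subrr res_d_aug.
case: e => e f [/= def /res_exact0[l fE]]; have [t tl] := psurj l.
have /res_exact0[k kE] : res_d E 0 (e - g t) = 0.
  by rewrite linearB -th0 tl fE.
exists (t + i k); rewrite /twist_aug !linearD gi kE addrC subrK.
have -> : p (i k) = 0 by apply/exT; exists k.
by rewrite linear0 addr0 tl fE.
Qed.

Fact twist_exact n e : twist_d (n := n.+1) e = 0 <-> exists u, twist_d (n := n) u = e.
Proof.
have [_ _ thd] := tw; split=> [|[[e' f'] <-]]; last first.
  by rewrite /twist_d /= linearD !res_dd add0r thd subrr.
case: e => e f [/= def /res_exact[f' fE]].
have /res_exact[e' eE] : res_d E n.+1 (e - th n f') = 0.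
  by rewrite linearB -thd fE.
by exists (e', f'); rewrite /twist_d /= eE subrK fE.
Qed.

Definition horseshoe_resolution : inj_resolution T :=
  @InjResolution R T twist_obj (fun n => @twist_d n) twist_aug
    (fun n => injective_mod_prod (@res_inj _ _ E n) (@res_inj _ _ F n))
    twist_aug_inj twist_exact0 twist_exact.

End Horseshoe.

Section LocalCohomology.
Variables (R : comNzRingType) (I : submodule R^o).

Lemma lmod_iso_trans (U V W : lmodType R) :
  lmod_iso U V -> lmod_iso V W -> lmod_iso U W.
Proof.
move=> [f fb] [h hb]; exists (h \o f); exact: bij_comp.
Qed.

Lemma lmod_iso_sym (U V : lmodType R) : lmod_iso U V -> lmod_iso V U.
Proof.
move=> [f [h fK hK]]; have hL : linear h.
  by move=> a u v; apply: (can_inj fK); rewrite linearP !hK.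
exists (HB.pack h (GRing.isLinear.Build R V U *:%R h hL) : {linear V -> U}).
by exists f.
Qed.

Lemma quot_pi_eq0 (V : lmodType R) (S : submodule V) (v : V) :
  (quot_pi S v == 0) = (v \in S).
Proof. by rewrite -(linear0 (quot_pi S)) quot_piE subr0. Qed.

Lemma subquot_lin_bij (U V : lmodType R) (f : {linear U -> V})
    (Z B : submodule U) (Z' B' : submodule V)
    (fZ : forall u, u \in Z -> f u \in Z') (fB : forall u, u \in B -> f u \in B') :
  (forall u, u \in Z -> f u \in B' -> u \in B) ->
  (forall v, v \in Z' -> exists2 u, u \in Z & v - f u \in B') ->
  bijective (subquot_lin fZ fB).
Proof.
move=> inj surj; apply: bij_of_inj_surj.
  apply: linear_eq0_inj => q; rewrite -(quot_reprK q) /= (subquot_mapE fZ fB).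
  move=> /eqP; rewrite quot_pi_eq0 => fr; apply/eqP; rewrite quot_pi_eq0.
  exact: inj (valP (quot_repr q)) fr.
move=> q; have [u uZ uB] := surj _ (valP (quot_repr q)).
exists (quot_pi _ (exist (fun u => u \in Z) u uZ : submod_type Z)).
rewrite /= (subquot_mapE fZ fB) -[RHS]quot_reprK; apply/eqP; rewrite eq_sym quot_piE.
exact: uB.
Qed.

(** A resolution of [M'] is one of [M] after composing its augmentation with the
    isomorphism. *)
Lemma local_cohomology_iso (M M' H : lmodType R) j :
  lmod_iso M M' -> is_local_cohomology I j M H -> is_local_cohomology I j M' H.
Proof.
move=> [f [h fK hK]] MH E.
have aug_inj : injective (res_aug E \o f).
  by move=> u v /res_aug_inj/(can_inj fK).
have exact0 e : res_d E 0 e = 0 <-> exists u, (res_aug E \o f) u = e.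
  split=> [/res_exact0[u <-]|[u <-]]; first by exists (h u); rewrite /= hK.
  exact: res_d_aug.
exact: (MH (@InjResolution R M (res_obj E) (res_d E) (res_aug E \o f)
  (@res_inj _ _ E) aug_inj exact0 (@res_exact _ _ E))).
Qed.

Lemma local_cohomology_torsion (M : lmodType R) :
  (forall u : M, u \in torsion I M) -> is_local_cohomology I 0 M M.
Proof.
move=> tM E; apply: lmod_iso_sym.
have augZ u : res_aug E u \in torsion_cocycles I E 0.
  by apply/andP; split; [exact: torsion_linear|apply/eqP; exact: res_d_aug].
pose f u : torsion_cohomology I E 0 :=
  quot_pi _ (exist (fun e => e \in torsion_cocycles I E 0) _ (augZ u)
    : submod_type (torsion_cocycles I E 0)).
have fL : linear f.
  move=> a u v; rewrite /f -linearP; congr (quot_pi _ _).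
  by apply: val_inj; rewrite /= linearP.
exists (HB.pack f (GRing.isLinear.Build R M _ *:%R f fL)
  : {linear M -> torsion_cohomology I E 0}).
apply: bij_of_inj_surj.
  apply: linear_eq0_inj => u /= /eqP; rewrite /f quot_pi_eq0 => /eqP /=.
  by rewrite -(linear0 (res_aug E)) => /res_aug_inj.
move=> q; have /andP[_ /eqP/res_exact0[u uE]] := valP (quot_repr q).
exists u; rewrite -[RHS]quot_reprK /= /f; congr (quot_pi _ _).
exact: val_inj.
Qed.

Lemma torsion_pair (U V : lmodType R) (u : U) (v : V) :
  ((u, v) \in torsion I (U * V)%type) = (u \in torsion I U) && (v \in torsion I V).
Proof.
apply/idP/andP => [tuv|[/asboolP[n nu] /asboolP[k kv]]].
  by split; [exact: (torsion_linear fst tuv)|exact: (torsion_linear snd tuv)].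
apply/asboolP; exists (maxn n k) => a aI; congr pair.
  by apply: nu; apply: ideal_pow_le aI; exact: leq_maxl.
by apply: kv; apply: ideal_pow_le aI; exact: leq_maxr.
Qed.

(** The long exact sequence of [0 -> K -> T -> L -> 0] reduces to its
    connecting maps, because [T] is acyclic. They are induced by the off-diagonal
    maps of the horseshoe resolution. *)
Lemma local_cohomology_shift (K T L H : lmodType R) (i : {linear K -> T})
    (p : {linear T -> L}) (c : R) j :
  injective i -> (forall l, exists t, p t = l) ->
  (forall t, p t = 0 <-> exists k, i k = t) ->
  c \in I -> (forall t : T, c *: t = 0 -> t = 0) ->
  (forall t : T, exists t', c *: t' = t) ->
  is_local_cohomology I j L H -> is_local_cohomology I j.+1 K H.
Proof.
move=> iinj psurj ex cI cinj csurj LH E; move: (std_resolution L) => F.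
apply: lmod_iso_trans (LH F); apply: lmod_iso_sym.
have [g [th tw]] := horseshoe_exists iinj psurj ex E F.
pose G := horseshoe_resolution psurj ex tw; have [_ _ thd] := tw.
have thZ u : u \in torsion_cocycles I F j -> th j u \in torsion_cocycles I E j.+1.
  move=> /andP[tu /eqP du]; apply/andP; split; first exact: torsion_linear.
  apply/eqP; apply: oppr_inj.
  by have := thd j u; rewrite du linear0 oppr0 => <-.
have thB u : u \in torsion_cobounds I F j -> th j u \in torsion_cobounds I E j.+1.
  case: j u {LH thZ} => [|j] u; first by move=> /eqP ->; rewrite linear0 rpred0.
  move=> /asboolP[v tv <-]; rewrite thd rpredN; apply/asboolP.
  by exists (th j v) => //; apply: torsion_linear.
exists (subquot_lin thZ thB); apply: subquot_lin_bij.
  move=> f /andP[tf /eqP df] /asboolP[e te eE].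
  have tG : ((- e, f) : twist_obj E F j) \in torsion I (twist_obj E F j).
    by rewrite torsion_pair rpredN te.
  have dG : res_d G j (- e, f) = 0.
    by rewrite /= /twist_d /= linearN eE addNr df.
  case: j {LH thZ thB} f e tf df te eE tG dG => [|j] f e tf df te eE tG dG.
    by have [_ ->] := torsion_acyclic0 (E := G) cI cinj tG dG; apply: rpred0.
  have [[e' f']] := torsion_acyclic (E := G) cI cinj csurj tG dG.
  rewrite torsion_pair => /andP[_ tf'] [_ fE]; apply/asboolP.
  by exists f'.
move=> e /andP[te /eqP de].
have [||[e' f']] := torsion_acyclic (E := G) (n := j) (z := (e, 0)) cI cinj csurj.
- by rewrite torsion_pair te rpred0.
- by rewrite /= /twist_d /= linear0 addr0 de linear0.
rewrite torsion_pair => /andP[te' tf'] [eE fE].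
exists f'; first by apply/andP; split=> //; apply/eqP.
by apply/asboolP; exists e'; rewrite // -eE addrK.
Qed.

End LocalCohomology.

(** * Inverse limits of annihilators *)

Section Artinian.
Variables (R : comNzRingType) (X : lmodType R).

(** Linear compactness of Artinian modules: the images of the cosets [F (n + k)]
    in [F n] stabilise, and multiplication by [q] is surjective between the
    stable images. *)
Lemma artinian_inverse_limit (q : R) (F : nat -> X -> Prop) (Z : nat -> submodule X) :
  artinian X -> (forall n, exists u, F n u) ->
  (forall n u v, F n u -> F n v <-> v - u \in Z n) ->
  (forall n u, F n.+1 u -> F n (q *: u)) ->
  exists u : nat -> X, forall n, F n (u n) /\ q *: u n.+1 = u n.
Proof.
move=> art ne FZ qF.
have qFk n k u : F (n + k)%N u -> F n (q ^+ k *: u).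
  elim: k u => [|k IH] u; first by rewrite addn0 scale1r.
  by rewrite addnS exprSr -scalerA => /qF/IH.
have qZ n z : z \in Z n.+1 -> q *: z \in Z n.
  move=> zZ; have [u Fu] := ne n.+1.
  have Fuz : F n.+1 (u + z) by apply/(FZ _ _ _ Fu); rewrite addrC addKr.
  have /(FZ _ _ _ (qF _ _ Fu)) := qF _ _ Fuz.
  by rewrite -scalerBr addrC addKr.
(* The stable image in F n. *)
pose E n u := forall k, exists2 v, F (n + k)%N v & q ^+ k *: v = u.
have key n : exists k, forall v, F (n + k)%N v -> E n (q ^+ k *: v).
  have [k Zk] : exists k, forall l, (k <= l)%N ->
      im_in (Z (n + l)%N) (q ^+ l) =i im_in (Z (n + k)%N) (q ^+ k).
    apply: (art (fun k => im_in (Z (n + k)%N) (q ^+ k))) => k u /im_inP[z zZ <-].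
    apply/im_inP; exists (q *: z); last by rewrite scalerA -exprSr.
    by apply: qZ; rewrite -addnS.
  exists k => v Fv l; have [lk|/ltnW kl] := leqP l k.
    exists (q ^+ (k - l) *: v); last by rewrite scalerA -exprD subnKC.
    by apply: qFk; rewrite -addnA subnKC.
  have [v' Fv'] := ne (n + l)%N.
  have Fv'k : F (n + k)%N (q ^+ (l - k) *: v').
    by apply: qFk; rewrite -addnA subnKC.
  have : q ^+ k *: (v - q ^+ (l - k) *: v') \in im_in (Z (n + k)%N) (q ^+ k).
    by apply/im_inP; exists (v - q ^+ (l - k) *: v') => //; apply/(FZ _ _ _ Fv'k).
  rewrite -(Zk l kl) => /im_inP[z zZ zE]; exists (v' + z).
    by apply/(FZ _ _ _ Fv'); rewrite addrC addKr.
  rewrite scalerDr zE scalerBr scalerA -exprD subnKC //.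
  by rewrite addrC subrK.
have E0 : exists u, E 0%N u.
  have [k Ek] := key 0%N; have [v Fv] := ne k.
  by exists (q ^+ k *: v); apply: Ek.
have [u0 Eu0] := E0.
have [||u _ uP] := @dependent_family (fun _ => X) E (fun n u u' => q *: u' = u) u0.
- exact: Eu0.
- move=> n u Eu; have [k Ek] := key n.+1; have [v Fv vu] := Eu k.+1.
  exists (q ^+ k *: v); last by rewrite scalerA -exprS.
  by apply: Ek; rewrite addSnnS.
exists u => n; split; last exact: (uP n).2.
have [v] := (uP n).1 0%N.
by rewrite addn0 scale1r => Fv <-.
Qed.

End Artinian.

Definition in_submod (R : comNzRingType) (V : lmodType R) (S : submodule V)
  (v : V) (vS : v \in S) : submod_type S := exist (fun w => w \in S) v vS.

Section Tower.
Variables (R : comNzRingType) (X : lmodType R).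
Implicit Types (q b : R) (s : seq R).

Definition powers n s := [seq b ^+ n.+1 | b <- s].

Definition tower_pred q s : {pred prod_mod (fun _ : nat => X)} :=
  fun u => `[< forall n, u n \in colon X (powers n s) /\ q *: u n.+1 = u n >].
Fact tower_closed q s : GRing.submod_closed (tower_pred q s).
Proof.
split=> [|a u v /asboolP uP /asboolP vP]; apply/asboolP => n.
  by split; [apply: rpred0 | apply: scaler0].
have [[us qu] [vs qv]] := (uP n, vP n); split; first by rewrite rpredD ?rpredZ.
change (q *: (a *: u n.+1 + v n.+1) = a *: u n + v n).
by rewrite scalerDr qv scalerA mulrC -scalerA qu.
Qed.
(** With [q] the product of [s] this is the inverse limit of the [0 :_X s^(n+1)]
    along the Koszul transition maps. With an extra factor [b] in [q] it is the
    module on which [b] becomes invertible. *)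
Definition tower q s := Submodule (tower_closed q s).

Lemma towerP q s (u : prod_mod (fun _ : nat => X)) :
  reflect (forall n, u n \in colon X (powers n s) /\ q *: u n.+1 = u n)
          (u \in tower q s).
Proof. exact: asboolP. Qed.

Lemma prod_colon n s u :
  u \in colon X (powers n.+1 s) -> \prod_(b <- s) b *: u \in colon X (powers n s).
Proof.
move=> /allP us; apply/allP => _ /mapP[b bs ->].
rewrite (big_rem b) //= scalerA mulrA -exprSr mulrC -scalerA.
by rewrite (eqP (us _ (map_f (fun b => b ^+ n.+2) bs))) scaler0.
Qed.

Section Restrict.
Variables (U V : lmodType R) (f : {linear U -> V}).
Variables (S : submodule U) (S' : submodule V).
Hypothesis fS : forall u, u \in S -> f u \in S'.
Fact restrict_linear : linear (Defs.sub_map fS).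
Proof. by move=> a u v; apply: val_inj; rewrite /= linearP. Qed.
Definition restrict_lin : {linear submod_type S -> submod_type S'} :=
  HB.pack (Defs.sub_map fS)
    (GRing.isLinear.Build R (submod_type S) (submod_type S') *:%R (Defs.sub_map fS)
       restrict_linear).
End Restrict.

Definition pow_scale b (u : prod_mod (fun _ : nat => X)) :
  prod_mod (fun _ : nat => X) :=
  fun n => b ^+ n.+1 *: u n.
Fact pow_scale_linear b : linear (pow_scale b).
Proof.
move=> a u v; apply: funext => n; change (b ^+ n.+1 *: (a *: u n + v n) =
  a *: (b ^+ n.+1 *: u n) + b ^+ n.+1 *: v n).
by rewrite scalerDr !scalerA mulrC.
Qed.
HB.instance Definition _ b := GRing.isLinear.Build R _ _ *:%R (pow_scale b)
  (pow_scale_linear b).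

(** The shift is along [0 -> L(b :: s) -> T -> L(s) -> 0], where [T] is
    [tower (b * P) s]. On [T], [b] is injective since [u_n = P b u_(n+1)], and
    [(P u_(n+1))] is a preimage of [(u_n)]. *)
Lemma local_cohomology_tower (I : submodule R^o) s : artinian X ->
  (forall u : X, u \in torsion I X) -> {subset s <= I} ->
  (forall n, coregular_rev X (powers n s)) ->
  is_local_cohomology I (size s) (submod_type (tower (\prod_(b <- s) b) s)) X.
Proof.
move=> art tX; elim: s => [|b s IH] sI cs.
  rewrite big_nil; apply: local_cohomology_iso (local_cohomology_torsion tX).
  have cP (u : X) : (fun _ => u) \in tower 1 [::].
    by apply/towerP => n; rewrite scale1r.
  pose f u : submod_type (tower 1 [::]) := in_submod (cP u).
  have fL : linear f by move=> a u v; apply: val_inj.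
  exists (HB.pack f (GRing.isLinear.Build R X _ *:%R f fL)
    : {linear X -> submod_type (tower 1 [::])}).
  apply: bij_of_inj_surj => [u v /(congr1 (fun w => val w 0%N)) //|w].
  have /towerP wP := valP w; exists (val w 0%N); apply: val_inj; apply: funext => n /=.
  by elim: n => // n ->; rewrite -(wP n).2 scale1r.
rewrite big_cons; set P := \prod_(b <- s) b in IH *.
have sub u : u \in tower (b * P) (b :: s) -> idfun u \in tower (b * P) s.
  move=> /towerP uP; apply/towerP => n; have [] := uP n.
  by rewrite colon_cons => /andP[].
have ps u : u \in tower (b * P) s -> pow_scale b u \in tower P s.
  move=> /towerP uP; apply/towerP => n; have [us qu] := uP n.
  split; first exact: rpredZ.
  by rewrite /pow_scale -qu !scalerA mulrA -exprSr mulrC.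
apply: (@local_cohomology_shift _ _ _ (submod_type (tower (b * P) s)) _ _
  (restrict_lin sub) (restrict_lin ps) b).
- by move=> u v uv; apply: val_inj; exact: (congr1 val uv).
- move=> w; have /towerP wP := valP w.
  (* A preimage of w is a point of the inverse limit of the solution sets of
     b^(n+1) u = w_n, which are cosets of 0 :_X (b :: s)^(n+1). *)
  have [|||u uP] := @artinian_inverse_limit R X (b * P)
    (fun n u => u \in colon X (powers n s) /\ b ^+ n.+1 *: u = val w n)
    (fun n => colon X (powers n (b :: s))) art.
  + by move=> n; have [v] := (cs n).1 _ (wP n).1; exists v.
  + move=> n u v [us bu]; rewrite colon_cons scalerBr bu subr_eq0.
    split=> [[vs ->]|/andP[/eqP -> vus]]; first by rewrite eqxx rpredB.
    by rewrite -(subrK u v) rpredD.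
  + move=> n u [us bu]; rewrite -scalerA; split; first exact/rpredZ/prod_colon.
    by rewrite -(wP n).2 -bu !scalerA -exprSr mulrC.
  have uT : u \in tower (b * P) s by apply/towerP => n; have [[]] := uP n.
  exists (in_submod uT); apply: val_inj; apply: funext => n.
  by have [[_]] := uP n.
- move=> t; split=> [/(congr1 val) /= pt|[k <-]].
    have tK : val t \in tower (b * P) (b :: s).
      have /towerP tP := valP t; apply/towerP => n; have [ts qt] := tP n.
      rewrite colon_cons ts andbT; split=> //; apply/eqP.
      exact: (congr1 (fun u => u n) pt).
    by exists (in_submod tK); apply: val_inj.
  apply: val_inj; apply: funext => n /=; have /towerP kP := valP k.
  by have [] := kP n; rewrite colon_cons => /andP[/eqP].
- by apply: sI; rewrite mem_head.
- move=> t bt; apply: val_inj; change (val t = 0).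
  have {bt} : b *: val t = 0 := congr1 val bt.
  move: (valP t); move: (val t) => u /towerP uP bu; apply: funext => n.
  rewrite -(uP n).2 mulrC -scalerA (_ : b *: u n.+1 = 0) ?scaler0 //.
  exact: (congr1 (fun u => u n.+1) bu).
- move=> t; suff [v vT bv] : exists2 v, v \in tower (b * P) s & b *: v = val t.
    by exists (in_submod vT); apply: val_inj.
  move: (valP t); move: (val t) => u /towerP uP.
  exists (fun n => P *: u n.+1).
    apply/towerP => n; split; first exact/prod_colon/(uP n.+1).1.
    by rewrite -(uP n.+1).2 !scalerA mulrCA mulrA.
  apply: funext => n; rewrite -(uP n).2 -scalerA //.
apply: IH => [c cs'|n]; first by apply: sI; rewrite inE cs' orbT.
exact: (cs n).2.
Qed.

End Tower.

(** * Torsion with respect to a finitely generated ideal *)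

Section IdealTorsion.
Variables (R : comNzRingType) (X : lmodType R) (x : seq R).
Let I := ideal_span [set a | a \in x]%classic.

Lemma mem_ideal_span a : a \in x -> (a : R^o) \in I.
Proof. by move=> ax; apply/asboolP => J; apply. Qed.

Lemma torsion_step (u : X) :
  (forall a, a \in x -> a *: u \in torsion I X) -> u \in torsion I X.
Proof.
move=> tu; have [n nu] : exists n, forall a b : R,
    a \in x -> b \in ideal_pow I n -> b *: (a *: u) = 0.
  elim: (x) tu => [|c y IH] tu; first by exists 0%N.
  have [a ay|n nu] := IH; first by apply: tu; rewrite inE ay orbT.
  have /asboolP[k ku] := tu c (mem_head c y).
  exists (maxn n k) => a b; rewrite inE => /orP[/eqP ->|ay] bI.
    by apply: ku; apply: ideal_pow_le bI; exact: leq_maxr.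
  by apply: nu => //; apply: ideal_pow_le bI; exact: leq_maxl.
apply/asboolP; exists n.+1 => r /asboolP rI; apply/eqP.
apply: (rI (annihilator u)) => _ [a [b [/asboolP aI bI ->]]].
have : a \in annihilator ((b : R) *: u).
  apply: aI => c cx.
  by rewrite annihilatorE scalerA mulrC -scalerA nu.
by rewrite !annihilatorE scalerA.
Qed.

(** By [torsion_step] it is enough that each [a u] is torsion, and [a u] satisfies
    the hypotheses with a smaller exponent for [a]. *)
Lemma nilpotent_torsion (u : X) :
  (forall a, a \in x -> exists n, a ^+ n *: u = 0) -> u \in torsion I X.
Proof.
(* The entries of y are those still to be treated; for the others, a u is
   already known to be torsion. *)
suff H (y : seq R) : forall u : X, (forall a, a \in x ->
    a *: u \in torsion I X \/ a \in y /\ exists n, a ^+ n *: u = 0) ->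
    u \in torsion I X.
  by move=> nu; apply: (H x) => a ax; right; split=> //; apply: nu.
elim: y => [|b y IH] v tv.
  by apply: torsion_step => a /tv[|[]].
have [bv|nbv] := pselect (b *: v \in torsion I X).
  apply: IH => a /tv[|[]]; first by left.
  by rewrite inE => /orP[/eqP ->|ay nv]; [left | right].
have [bx|bx] := boolP (b \in x); last first.
  apply: IH => a ax; have [|[]] := tv a ax; first by left.
  rewrite inE => /orP[/eqP ab|ay nv]; last by right.
  by rewrite -ab ax in bx.
have [//|[_ [n bv]]] := tv b bx.
elim: n v tv nbv bv => [|n IHn] v tv nbv bv.
  by rewrite -[v]scale1r -(expr0 b) bv rpred0.
apply: contrapT => _; apply: nbv.
have tbv a : a \in x -> a *: (b *: v) \in torsion I X \/
    a \in b :: y /\ exists k, a ^+ k *: (b *: v) = 0.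
  move=> /tv[av|[ay [k ak]]]; first by left; rewrite scalerA mulrC -scalerA rpredZ.
  by right; split=> //; exists k; rewrite scalerA mulrC -scalerA ak scaler0.
have [bbv|nbbv] := pselect (b *: (b *: v) \in torsion I X); last first.
  by apply: IHn tbv nbbv _; rewrite scalerA -exprSr.
apply: IH => a ax; have [|[]] := tbv a ax; first by left.
by rewrite inE => /orP[/eqP ->|ay nv]; [left | right].
Qed.

End IdealTorsion.

(** * Top local homology is the limit of the tower *)

Section TopKoszul.
Variables (R : comNzRingType) (X : lmodType R) (r : nat).
Implicit Types (t : 'I_r -> R) (v : X).

Definition top_elt v : koszul r X :=
  [ffun A : {set 'I_r} => if A == [set: 'I_r]%SET then v else 0].

Fact top_elt_linear : linear top_elt.
Proof.
move=> a u v; apply/ffunP => A; rewrite !ffunE.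
by case: ifP => _ //; rewrite scaler0 addr0.
Qed.

Lemma koszul_bounds_top t (f : koszul r X) : f \in koszul_bounds X t r -> f = 0.
Proof.
move=> /asboolP[g /forallP gd <-].
suff -> : g = 0 by rewrite linear0.
apply/ffunP => A; rewrite ffunE; apply/eqP; apply: (implyP (gd A)).
by rewrite neq_ltn ltnS (leq_trans (max_card _)) // card_ord.
Qed.

Lemma koszul_deg_top (f : koszul r X) :
  f \in koszul_deg r X r -> f = top_elt (f [set: 'I_r]%SET).
Proof.
move=> /forallP fd; apply/ffunP => A; rewrite ffunE; case: eqP => [-> //|AT].
apply/eqP; apply: (implyP (fd A)); apply/eqP => cA; apply: AT.
by apply/eqP; rewrite eqEcard finset.subsetT cardsT card_ord cA leqnn.
Qed.

Lemma koszul_d_top t v :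
  (koszul_d t (top_elt v) == 0) = [forall j, t j *: v == 0].
Proof.
apply/eqP/forallP => [d0 j|tv].
  have := congr1 (fun f : koszul r X => f [set~ j]%SET) d0.
  rewrite !ffunE (bigD1 j) /= ?inE ?eqxx // big1 ?addr0.
    rewrite ffunE finset.setUCr eqxx -scalerA => /eqP.
    rewrite -signr_odd; case: odd; rewrite ?expr0 ?scale1r //.
    by rewrite expr1 scaleN1r oppr_eq0.
  by move=> k; rewrite !inE negbK => /andP[/eqP -> /eqP].
apply/ffunP => B; rewrite !ffunE big1 // => j jB.
rewrite ffunE; case: ifP => _; last exact: scaler0.
by rewrite -scalerA (eqP (tv j)) scaler0.
Qed.

Lemma koszul_cycles_top t v :
  (top_elt v \in koszul_cycles X t r) = [forall j, t j *: v == 0].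
Proof.
rewrite -koszul_d_top; apply: andb_idl => _; apply/forallP => A; rewrite ffunE.
by case: ifP => [/eqP ->|_]; rewrite ?cardsT ?card_ord ?eqxx ?implybT.
Qed.

End TopKoszul.

Section TopLocalHomology.
Variables (R : comNzRingType) (X : lmodType R) (d : nat) (x : d.-tuple R).

Lemma top_cycles_colon n (v : X) :
  (top_elt d v \in koszul_cycles X (pow (tnth x) n.+1) d)
  = (v \in colon X (powers n x)).
Proof.
rewrite koszul_cycles_top; apply/forallP/allP => [xv _ /mapP[a /tnthP[j ->] ->]|xv j].
  exact: xv.
by apply: xv; apply/map_f/mem_tnth.
Qed.

(** There are no boundaries in top degree, and a top chain is determined by its
    single coefficient. *)
Lemma local_homology_top :
  lmod_iso (submod_type (tower X (\prod_(b <- x) b) x)) (local_homology X d (tnth x)).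
Proof.
set q := \prod_(b <- x) b.
have cyc (u : submod_type (tower X q x)) n :
    top_elt d (val u n) \in koszul_cycles X (pow (tnth x) n.+1) d.
  by rewrite top_cycles_colon; have /towerP/(_ n)[] := valP u.
pose f0 u : prod_mod (fun n => koszul_homology X (pow (tnth x) n.+1) d) :=
  fun n => quot_pi _ (in_submod (cyc u n)).
have koszul_t_top v : koszul_t (tnth x) (top_elt d v) = top_elt d (q *: v).
  apply/ffunP => A; rewrite !ffunE; case: (A =P _) => [->|_]; last exact: scaler0.
  by rewrite /q big_tuple; congr (_ *: _); apply: eq_bigl => j; rewrite inE.
have fP u : `[< forall n, koszul_homology_t X (tnth x) d n.+1 (f0 u n.+1) = f0 u n >].
  apply/asboolP => n; rewrite /f0 /=.
  rewrite (subquot_mapE (@koszul_t_cycles R d X (tnth x) d n.+1)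
    (@koszul_t_bounds R d X (tnth x) d n.+1)); congr (quot_pi _ _).
  apply: val_inj; rewrite /= koszul_t_top.
  by have /towerP uP := valP u; rewrite (uP n).2.
pose f u : local_homology X d (tnth x) := exist _ (f0 u) (fP u).
have fL : linear f.
  move=> a u v; apply: val_inj; apply: functional_extensionality_dep => n.
  change (f0 (a *: u + v) n = a *: f0 u n + f0 v n).
  rewrite /f0 -linearP; congr (quot_pi _ _); apply: val_inj.
  exact: top_elt_linear.
exists (HB.pack f (GRing.isLinear.Build R _ _ *:%R f fL)
  : {linear submod_type (tower X q x) -> local_homology X d (tnth x)}).
apply: bij_of_inj_surj.
  apply: linear_eq0_inj => u fu; apply: val_inj; apply: funext => n.
  have : f0 u n = 0 := congr1 (fun h => val h n) fu.
  move=> /eqP; rewrite quot_pi_eq0 => /koszul_bounds_top/ffunP/(_ [set: 'I_d]%SET).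
  by rewrite !ffunE eqxx.
move=> h; pose z n := val (quot_repr (val h n)).
pose u n := z n [set: 'I_d]%SET.
have zE n : z n = top_elt d (u n).
  by apply: koszul_deg_top; have /andP[] := valP (quot_repr (val h n)).
have uT : u \in tower X q x.
  apply/towerP => n; split.
    by rewrite -top_cycles_colon -zE; apply: valP.
  have /asboolP/(_ n) := valP h.
  rewrite -[val h n]quot_reprK -[val h n.+1]quot_reprK /=.
  rewrite (subquot_mapE (@koszul_t_cycles R d X (tnth x) d n.+1)
    (@koszul_t_bounds R d X (tnth x) d n.+1)).
  move=> /eqP; rewrite quot_piE => /koszul_bounds_top /eqP.
  rewrite raddfB subr_eq0 => /eqP /=.
  change (koszul_t (tnth x) (z n.+1) = z n -> q *: u n.+1 = u n).
  rewrite !zE koszul_t_top => /ffunP/(_ [set: 'I_d]%SET).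
  by rewrite !ffunE eqxx.
exists (in_submod uT); apply: val_inj; apply: functional_extensionality_dep => n.
rewrite -[RHS]quot_reprK; congr (quot_pi _ _); apply: val_inj.
exact/esym/zE.
Qed.

End TopLocalHomology.

(** * The isomorphism *)

Lemma Ndim_lt_le (R : comNzRingType) (V : lmodType R) k l :
  (k <= l)%N -> Ndim_lt k V -> Ndim_lt l V.
Proof. by move=> /subnK <-; elim: (l - k)%N => // j IH /IH; left. Qed.

Lemma Ndim_eq_unique (R : comNzRingType) (V : lmodType R) (k l : nat) :
  Ndim_eq V k%:Z -> Ndim_eq V l%:Z -> k = l.
Proof.
have H i j : Ndim_eq V i%:Z -> Ndim_eq V j%:Z -> (j <= i)%N.
  move=> Vi [nVj _]; rewrite leqNgt; apply/negP => ij; apply: nVj.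
  by apply: Ndim_lt_le ij _; right.
by move=> Vk Vl; apply/eqP; rewrite eqn_leq !H.
Qed.

Theorem theorem3p4 (R : comNzRingType) (m : submodule R^o) (X : lmodType R)
    (d : nat) (x : d.-tuple R) :
  local_ring m ->
  artinian X ->
  Ndim_eq X d%:Z ->
  {subset x <= m} ->
  finite_length (submod_type (colon X x)) ->
  co_Cohen_Macaulay m X ->
  is_local_cohomology (ideal_span [set a | a \in x]%classic) d
    (local_homology X d (tnth x)) X.
Proof.
move=> locR art dimX xm fl [w [[s [sm cs sw _]] dimXw]].
apply: local_cohomology_iso (local_homology_top X x) _.
rewrite -[in X in is_local_cohomology _ X](size_tuple x).
apply: local_cohomology_tower => // [u|a|n].
- apply: nilpotent_torsion => a ax.
  exact (artinian_locally_nilpotent locR u art (xm a ax)).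
- exact: mem_ideal_span.
apply: parameters_coregular_rev locR art sm xm cs _ fl.
by rewrite sw size_tuple; apply: Ndim_eq_unique dimXw dimX.
Qed.
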